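(* Let $(X,0)$ be a germ of a complex analytic variety, let $S_1,\dots,S_r$ be totally ordered abelian semigroups, each with minimal element $0$, let $\mathbb S=S_1\times\cdots\times S_r$, and let $\underline{\nu}=(\nu_1,\dots,\nu_r)$ be a collection of order functions $\nu_i:\mathcal O_{X,0}\to S_i\cup\{\infty\}$ with associated multi-index filtration $\{J(\underline v)\}_{\underline v\in\mathbb S}$. Assume that $\dim \mathcal O_{X,0}/J(\underline v)<\infty$ for every $\underline v\in\mathbb S$ (and therefore the Hilbert series and the generalized Poincaré series are defined). Then the Hilbert function $h$, the Hilbert series $\widetilde H(\underline t)$ and the generalized Poincaré series $P_g(\underline t;q)$ of the filtration are equivalent in the sense that each of them determines the other two. (That is, if two such collections of order functions on $\mathcal O_{X,0}$ with values in the same semigroups $S_1,\dots,S_r$ have the same one of these three invariants, then they have the same other two.)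
   Context: $\mathcal O_{X,0}$ is the ring of germs of holomorphic functions on the germ $(X,0)$. An order function on $\mathcal O_{X,0}$ with values in a totally ordered abelian semigroup $S$ (with minimal element $0$) is a map $\nu:\mathcal O_{X,0}\to S\cup\{\infty\}$ such that (1) $\nu(\lambda g)=\nu(g)$ for $\lambda\in\mathbb C^*$ and $\nu(0)=\infty$; (2) $\nu(g_1+g_2)\ge\min\{\nu(g_1),\nu(g_2)\}$. $\mathbb S$ is partially ordered componentwise. For $\underline v=(v_1,\dots,v_r)\in\mathbb S$: $J(\underline v)=\{g\in\mathcal O_{X,0}:\nu_i(g)\ge v_i \text{ for all } i=1,\dots,r\}$ and $J^+(\underline v)=\{g\in\mathcal O_{X,0}:\nu_i(g)>v_i\text{ for all }i=1,\dots,r\}$. These are complex vector subspaces. $\mathbb Z[[\mathbb S]]$ is the set of formal expressions $\sum_{\underline v\in\mathbb S}a_{\underline v}\,\underline t^{\underline v}$ with $a_{\underline v}\in\mathbb Z$ (similarly $\mathbb Z[q][[\mathbb S]]$ with coefficients in $\mathbb Z[q]$). Hilbert function: $h(\underline v)=\dim_{\mathbb C}\mathcal O_{X,0}/J(\underline v)$, $\underline v\in\mathbb S$. Hilbert series: $\widetilde H(\underline t)=\sum_{\underline v\in\mathbb S}h(\underline v)\,\underline t^{\underline v}$. Put $Y(\underline v)=\{g\in\mathcal O_{X,0}:\nu_i(g)=v_i\text{ for all }i\}$, and let $F_{\underline v}=Y(\underline v)/J^+(\underline v)$ be the image of $Y(\underline v)$ in $J(\underline v)/J^+(\underline v)$;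 it is the complement in $J(\underline v)/J^+(\underline v)$ of finitely many vector subspaces. Its projectivization $\mathbb PF_{\underline v}=(F_{\underline v}\setminus\{0\})/\mathbb C^*$ is the complement of an arrangement of projective subspaces in a projective space. Let $K_0$ be the Grothendieck ring of complex quasi-projective varieties (generated by isomorphism classes $[Z]$ with $[Z]=[Z']+[Z\setminus Z']$ for $Z'$ Zariski closed in $Z$, multiplication induced by Cartesian product), $\mathbb L=[\mathbb C]$; the map $\mathbb Z[\mathbb L]\to K_0$ is injective. The class $[\mathbb PF_{\underline v}]$ is a polynomial in $\mathbb L$, written $[\mathbb PF_{\underline v}]=p_{\underline v}(\mathbb L)$ (zero if $F_{\underline v}$ is empty). Generalized Poincaré series: with $q=\mathbb L^{-1}$ and $h^+(\underline v)=\dim_{\mathbb C}\mathcal O_{X,0}/J^+(\underline v)$, $$P_g(\underline t;q)=\sum_{\underline v\in\mathbb S}q^{h^+(\underline v)-1}\,p_{\underline v}(q^{-1})\,\underline t^{\underline v}\in\mathbb Z[q][[\mathbb S]].$$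
   Formalization: Added, as the claim fails without them: no S_i has a largest element; and, only for ''P_g determines h and the Hilbert series'', in both collections, if {ν_i=∞} has finite codimension then every ν_j is ∞ on it. Injectivity of Z[L]→K_0 is assumed. *)

(* Defs.v *)
From HB Require Import structures.
From mathcomp Require Import all_boot all_order all_algebra.
From mathcomp Require Import ring_quotient generic_quotient complex.
From mathcomp Require Import -(notations) mpoly monalg.
From mathcomp Require Import all_classical all_reals.
From mathcomp Require Import topology normedtype derive.

Set Implicit Arguments.
Unset Strict Implicit.
Unset Printing Implicit Defensive.

Import Order.TTheory GRing.Theory Num.Theory.
Import numFieldNormedType.Exports.

Local Open Scope classical_set_scope.
Local Open Scope ring_scope.
Local Open Scope complex_scope.
Local Open Scope quotient_scope.

(* {ideal_quot _} only covers proper ideals; here the quotient may be zero. *)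
Section PzQuotient.
Variables (A : comPzRingType) (I : zmodClosed A).
Hypothesis I_mul : forall a x, x \in I -> a * x \in I.

Definition pzq_mul (x y : Quotient.quot I) : Quotient.quot I :=
  \pi_(Quotient.quot I) (repr x * repr y).

Lemma pzq_eqP (x y : A) :
  reflect (\pi_(Quotient.quot I) x = \pi_(Quotient.quot I) y) (x - y \in I).
Proof. by rewrite Quotient.idealrBE; exact: eqP. Qed.

Lemma pzq_reprP (x : A) : repr (\pi_(Quotient.quot I) x) - x \in I.
Proof. by apply/pzq_eqP; rewrite reprK. Qed.

Lemma pi_pzq_mul (x y : A) :
  \pi_(Quotient.quot I) (x * y) =
  pzq_mul (\pi_(Quotient.quot I) x) (\pi_(Quotient.quot I) y).
Proof.
apply/esym/pzq_eqP; set x' := repr _; set y' := repr _.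
have -> : x' * y' - x * y = y' * (x' - x) + x * (y' - y).
  by rewrite !mulrBr [x * y']mulrC addrA subrK [y' * x']mulrC.
by apply: rpredD; apply: I_mul; exact: pzq_reprP.
Qed.

Lemma pzq_mulA : associative pzq_mul.
Proof.
elim/quotW=> x; elim/quotW=> y; elim/quotW=> z.
by rewrite -(pi_pzq_mul y z) -(pi_pzq_mul x y) -!(pi_pzq_mul _ _) mulrA.
Qed.

Lemma pzq_mulC : commutative pzq_mul.
Proof. by move=> x y; rewrite /pzq_mul mulrC. Qed.

Lemma pzq_mul1 : left_id (\pi_(Quotient.quot I) 1) pzq_mul.
Proof. by elim/quotW=> x; rewrite -(pi_pzq_mul 1 x) mul1r. Qed.

Lemma pzq_mulDl : left_distributive pzq_mul +%R.
Proof.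
elim/quotW=> x; elim/quotW=> y; elim/quotW=> z.
rewrite -raddfD -(pi_pzq_mul (x + y) z) mulrDl raddfD.
by congr (_ + _); exact: pi_pzq_mul.
Qed.

End PzQuotient.

(* C^(n+1), which is no loss: a germ in C^n is also a germ in C^(n+1). *)
Definition cspace (R : realType) (n : nat) : normedModType R[i] :=
  'rV[R[i]]_n.+1.

Section Germs.
Variables (R : realType) (n : nat).
Local Notation C := R[i].
Local Notation V := (cspace R n).

(* Holomorphic near the origin of C^(n+1): C-differentiable at every point of
   some neighbourhood; the values outside of that neighbourhood are irrelevant
   and are forgotten in [OX]. *)
Definition holo : {pred V -> C^o} :=
  fun f => `[< \forall z \near (0 : V), differentiable f z >].

Fact holo_subring : subring_closed holo.
Proof.
have FF : Filter (nbhs (0 : V)) by exact: nbhs_filter.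
split.
- by apply/asboolP; apply: filterE => z; exact: differentiable_cst.
- move=> f g /asboolP df /asboolP dg; apply/asboolP.
  by apply: filterS2 df dg => z; exact: differentiableB.
- move=> f g /asboolP df /asboolP dg; apply/asboolP.
  by apply: filterS2 df dg => z; exact: differentiableM.
Qed.

Record holo_fun := HoloFun { holo_val :> V -> C^o; _ : holo_val \in holo }.
HB.instance Definition _ := [isSub for holo_val].
HB.instance Definition _ := [Choice of holo_fun by <:].
HB.instance Definition _ :=
  GRing.SubChoice_isSubComPzRing.Build (V -> C^o) holo holo_fun holo_subring.

Record analytic_germ := AnalyticGerm {
  germ_set : set V;
  germ0 : germ_set 0;
  germ_analytic : exists k (f : 'I_k -> holo_fun),
    \forall z \near (0 : V), germ_set z <-> forall j, f j z = 0 }.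

Variable X : analytic_germ.

Definition germ_ideal : {pred holo_fun} :=
  fun f => `[< \forall z \near (0 : V), germ_set X z -> f z = 0 >].

Fact germ_ideal_zmod : zmod_closed germ_ideal.
Proof.
have FF : Filter (nbhs (0 : V)) by exact: nbhs_filter.
split; first by apply/asboolP; apply: filterE.
move=> f g /asboolP f0 /asboolP g0; apply/asboolP.
apply: filterS2 f0 g0 => z fz gz Xz.
have -> : (f - g : holo_fun) z = f z - g z by [].
by rewrite fz // gz // subrr.
Qed.
HB.instance Definition _ :=
  GRing.isZmodClosed.Build holo_fun germ_ideal germ_ideal_zmod.

Fact germ_ideal_mul (f g : holo_fun) : g \in germ_ideal -> f * g \in germ_ideal.
Proof.
have FF : Filter (nbhs (0 : V)) by exact: nbhs_filter.
move=> /asboolP g0; apply/asboolP; apply: filterS g0 => z gz Xz.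
have -> : (f * g : holo_fun) z = f z * g z by [].
by rewrite gz // mulr0.
Qed.

(* Holomorphic functions on X are the restrictions of holomorphic functions on
   the ambient space, so O_(X,0) is the quotient by the germs vanishing on X. *)
Definition OX := Quotient.quot germ_ideal.
HB.instance Definition _ := GRing.Zmodule.on OX.
HB.instance Definition _ := GRing.Zmodule_isComPzRing.Build OX
  (pzq_mulA germ_ideal_mul) (@pzq_mulC _ germ_ideal)
  (pzq_mul1 germ_ideal_mul) (pzq_mulDl germ_ideal_mul).


Fact holo_cst_subproof (a : C) : (cst a : V -> C^o) \in holo.
Proof. by apply/asboolP; apply: filterE => z; exact: differentiable_cst. Qed.
Definition holo_cst (a : C) : holo_fun := HoloFun (holo_cst_subproof a).

Definition OX_scale (a : C) (x : OX) : OX :=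
  (\pi_(Quotient.quot germ_ideal) (holo_cst a) : OX) * x.

Fact OX_scaleA a b x : OX_scale a (OX_scale b x) = OX_scale (a * b) x.
Proof.
rewrite /OX_scale mulrA; congr (_ * _).
have -> : holo_cst (a * b) = holo_cst a * holo_cst b by exact: val_inj.
exact/esym/(pi_pzq_mul germ_ideal_mul).
Qed.

Fact OX_scale1 : left_id 1 OX_scale.
Proof.
move=> x; rewrite /OX_scale -[RHS]mul1r; congr (_ * _).
by have -> : holo_cst 1 = 1 by exact: val_inj.
Qed.

Fact OX_scaleDr : right_distributive OX_scale +%R.
Proof. by move=> a x y; rewrite /OX_scale mulrDr. Qed.

Fact OX_scaleDl x : {morph OX_scale^~ x : a b / a + b}.
Proof.
move=> a b; rewrite /OX_scale -mulrDl; congr (_ * _).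
have -> : holo_cst (a + b) = holo_cst a + holo_cst b by exact: val_inj.
exact: raddfD.
Qed.

HB.instance Definition _ := GRing.Zmodule_isLmodule.Build C OX
  OX_scaleA OX_scale1 OX_scaleDr OX_scaleDl.

End Germs.

(* The minimal element, 0 in additive notation, is [\bot]. *)
Record oSemigroupType (d : Order.disp_t) := OSemigroup {
  os_sort :> bOrderType d;
  os_add : os_sort -> os_sort -> os_sort;
  os_addA : associative os_add;
  os_addC : commutative os_add;
  os_leD : forall z x y, (x <= y)%O -> (os_add x z <= os_add y z)%O }.

(* S together with a largest element, written [None]. *)
Definition with_oo (S : Type) : Type := option S.

Section WithInfinity.
Variables (d : Order.disp_t) (S : orderType d).
Implicit Types x y : with_oo S.

Definition oo_le x y :=
  match x, y with
  | _, None => true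
  | None, Some _ => false
  | Some a, Some b => (a <= b)%O
  end.

Fact oo_le_refl : reflexive oo_le. Proof. by case=> /=. Qed.
Fact oo_le_anti : antisymmetric oo_le.
Proof. by case=> [a|] [b|] //= /le_anti ->. Qed.
Fact oo_le_trans : transitive oo_le.
Proof. by case=> [a|] [b|] [c|] //=; exact: le_trans. Qed.
Fact oo_le_total : total oo_le.
Proof. by case=> [a|] [b|] //=; exact: le_total. Qed.

HB.instance Definition _ := Choice.on (with_oo S).
HB.instance Definition _ := Order.Le_isPOrder.Build d (with_oo S)
  oo_le_refl oo_le_anti oo_le_trans.
HB.instance Definition _ := Order.POrder_isTotal.Build d (with_oo S)
  oo_le_total.
End WithInfinity.

Section Codimension.
Variables (K : fieldType) (E : lmodType K).

(* The classes of [e] form a basis of A / B. *)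
Definition basis_mod (A B : set E) (m : nat) (e : 'I_m -> E) : Prop :=
  [/\ forall i, A (e i),
      forall g, A g -> exists c : 'rV[K]_m, B (g - \sum_i c 0 i *: e i) &
      forall c : 'rV[K]_m, B (\sum_i c 0 i *: e i) -> c = 0].

Definition finite_codim (B : set E) : Prop :=
  exists m (e : 'I_m -> E), basis_mod setT B e.

Definition codim (B : set E) : nat :=
  xget 0%N [set m | exists e : 'I_m -> E, basis_mod setT B e].

End Codimension.

(* A subset of the projective space P(K^d) is represented by its set of
   homogeneous coordinate vectors, all of them nonzero; P(K^0) is empty. *)
Section Varieties.
Variable K : fieldType.

Definition homogeneous d (p : mpoly d K) : Prop :=
  exists k, p \is ishomog1 k mpoly.mdeg.

Definition proj_eq d (x y : 'rV[K]_d) : Prop :=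
  exists2 c : K, c != 0 & y = c *: x.

Definition ev d (p : mpoly d K) (x : 'rV[K]_d) : K := meval (x 0) p.

Definition zeros d (fs : seq (mpoly d K)) : set 'rV[K]_d :=
  [set x | forall f, f \in fs -> ev f x = 0].

Definition homogeneous_seq d (fs : seq (mpoly d K)) : Prop :=
  forall f, f \in fs -> homogeneous f.

Record qpvar d := QPVar {
  pts : set 'rV[K]_d;
  _ : exists fs gs, [/\ homogeneous_seq fs, homogeneous_seq gs &
        pts = [set x | x != 0 /\ zeros fs x] `\` zeros gs] }.

(* Morphisms are given on coordinate vectors, up to a scalar; near each point
   (on a basic open set g != 0) they are given by forms of the same degree. *)
Definition regular d e (Z : qpvar d) (W : qpvar e)
    (f : 'rV[K]_d -> 'rV[K]_e) : Prop :=
  (forall x, pts Z x -> pts W (f x)) /\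
  forall x, pts Z x ->
    exists (k : nat) (F : 'I_e -> mpoly d K) (g : mpoly d K),
    [/\ forall i, F i \is ishomog1 k mpoly.mdeg,
        homogeneous g, ev g x != 0 &
        forall y, pts Z y -> ev g y != 0 ->
          \row_i ev (F i) y != 0 /\ proj_eq (f y) (\row_i ev (F i) y)].

Definition isomorphic d e (Z : qpvar d) (W : qpvar e) : Prop :=
  exists f g, [/\ regular Z W f, regular W Z g,
    forall x, pts Z x -> proj_eq x (g (f x)) &
    forall y, pts W y -> proj_eq y (f (g y))].

Definition closed_in d (Z' Z : qpvar d) : Prop :=
  exists2 gs, homogeneous_seq gs & pts Z' = pts Z `&` zeros gs.

(* The image of the Segre embedding of Z x W, in homogeneous coordinates. *)
Definition segre d e (Z : qpvar d) (W : qpvar e) : set 'rV[K]_(d * e) :=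
  [set x | exists z w, [/\ pts Z z, pts W w & x = mxvec (z^T *m w)]].

HB.instance Definition _ d := gen_eqMixin (qpvar d).
HB.instance Definition _ d := gen_choiceMixin (qpvar d).

(* The Grothendieck ring: the free commutative ring on all quasi-projective
   varieties, modulo the ideal generated by the relations below. *)
Definition K0_free : comNzRingType := malg (cmonom {d : nat & qpvar d}) int.

Definition K0_gen d (Z : qpvar d) : K0_free :=
  mkmalgU (ucm (existT _ d Z)) 1.

Inductive K0_rel : K0_free -> Prop :=
| K0_iso d e (Z : qpvar d) (W : qpvar e) :
    isomorphic Z W -> K0_rel (K0_gen Z - K0_gen W)
| K0_cut d (Z Z' Z'' : qpvar d) :
    closed_in Z' Z -> pts Z'' = pts Z `\` pts Z' ->
    K0_rel (K0_gen Z - (K0_gen Z' + K0_gen Z''))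
| K0_prod d e (Z : qpvar d) (W : qpvar e) (P : qpvar (d * e)) :
    pts P = segre Z W -> K0_rel (K0_gen P - K0_gen Z * K0_gen W)
| K0_point (P : qpvar 1) :
    pts P = [set x | x != 0] -> K0_rel (K0_gen P - 1)
| K0_zero : K0_rel 0
| K0_sub a b : K0_rel a -> K0_rel b -> K0_rel (a - b)
| K0_mul a b : K0_rel b -> K0_rel (a * b).

Definition K0_ideal : {pred K0_free} := fun a => `[< K0_rel a >].

Fact K0_ideal_zmod : zmod_closed K0_ideal.
Proof.
split=> [|a b /asboolP Ia /asboolP Ib]; apply/asboolP; first exact: K0_zero.
exact: K0_sub.
Qed.
HB.instance Definition _ :=
  GRing.isZmodClosed.Build K0_free K0_ideal K0_ideal_zmod.

Fact K0_ideal_mul a b : b \in K0_ideal -> a * b \in K0_ideal.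
Proof. by move=> /asboolP Ib; apply/asboolP; exact: K0_mul. Qed.

Definition K0 := Quotient.quot K0_ideal.
HB.instance Definition _ := GRing.Zmodule.on K0.
HB.instance Definition _ := GRing.Zmodule_isComPzRing.Build K0
  (pzq_mulA K0_ideal_mul) (@pzq_mulC _ K0_ideal)
  (pzq_mul1 K0_ideal_mul) (pzq_mulDl K0_ideal_mul).

Definition K0_class d (Z : qpvar d) : K0 :=
  \pi_(Quotient.quot K0_ideal) (K0_gen Z).

Fact affine_line_subproof : exists fs gs : seq (mpoly 2 K),
  [/\ homogeneous_seq fs, homogeneous_seq gs &
    [set x : 'rV[K]_2 | x 0 0 != 0] =
    [set x | x != 0 /\ zeros fs x] `\` zeros gs].
Proof.
exists [::], [:: mpolyX K (mpoly.mnm1 0)]; split=> //.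
  move=> f; rewrite inE => /eqP ->; exists 1%N.
  by rewrite dhomogX /= mpoly.mdeg1.
apply/seteqP; split=> x /=.
  move=> x0; split; first by split=> //; apply: contraNneq x0 => ->; rewrite mxE.
  move=> /(_ _ (mem_head _ _)) /eqP; rewrite /ev mevalXU.
  by rewrite (negbTE x0).
move=> [_ zx]; apply/eqP => x0; apply: zx => f; rewrite inE => /eqP ->.
by rewrite /ev mevalXU.
Qed.

(* The complement of a point in P^1. *)
Definition affine_line : qpvar 2 := QPVar affine_line_subproof.

Definition K0_L : K0 := K0_class affine_line.

Definition K0_poly (p : {poly int}) : K0 :=
  \sum_(k < size p) K0_L ^+ k *~ p`_k.

End Varieties.

Section Filtration.
Variables (R : realType) (n : nat) (X : analytic_germ R n).
Local Notation C := R[i].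
Local Notation O := (OX X).

Record order_fun (d : Order.disp_t) (S : oSemigroupType d) := OrderFun {
  order_val :> O -> with_oo S;
  order_scale : forall (a : C) (g : O), a != 0 ->
    order_val (a *: g) = order_val g;
  order_0 : order_val 0 = None;
  order_add : forall g1 g2 : O,
    (Order.min (order_val g1) (order_val g2) <= order_val (g1 + g2))%O }.

Variables (r : nat) (d : Order.disp_t) (S : 'I_r -> oSemigroupType d).
Variable nu : forall i, order_fun (S i).
Local Notation SS := (forall i, S i).

Definition J (v : SS) : set O :=
  [set g | forall i, (Some (v i) <= nu i g :> with_oo (S i))%O].

Definition Jplus (v : SS) : set O :=
  [set g | forall i, (Some (v i) < nu i g :> with_oo (S i))%O].

Definition Y (v : SS) : set O := [set g | forall i, nu i g = Some (v i)].

Definition hilbert_fun (v : SS) : nat := codim (J v).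

Definition hilbert_fun_plus (v : SS) : nat := codim (Jplus v).

(* In the coordinates given by a basis of J v / Jplus v. *)
Definition PF_coords (v : SS) m (e : 'I_m -> O) : set 'rV[C]_m :=
  [set c | c != 0 /\ exists2 g, Y v g & Jplus v (\sum_i c 0 i *: e i - g)].

(* [PF_v], which does not depend on the basis. *)
Definition PF_class (v : SS) : K0 C :=
  xget 0 [set a | exists m (e : 'I_m -> O) (Z : qpvar C m),
    [/\ basis_mod (J v) (Jplus v) e, pts Z = PF_coords v e &
        a = K0_class Z]].

Definition PF_poly (v : SS) : {poly int} :=
  xget 0 [set p | K0_poly C p = PF_class v].

(* Formal series are functions from exponents to coefficients. *)
Definition hilbert_series (v : SS) : int := hilbert_fun v.

(* q^(h^+ - 1) * p(1/q); no exponent is truncated since the degree of p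
   is at most dim (J v / Jplus v) - 1. *)
Definition poincare_series (v : SS) : {poly int} :=
  \sum_(k < size (PF_poly v))
     (PF_poly v)`_k *: 'X^((hilbert_fun_plus v).-1 - k).

(* If nu_i is infinite on a subspace of finite codimension, then all the nu_j are
   infinite on that subspace. Automatic for r = 1; also satisfied if every
   [nu_i = oo] has infinite codimension, as for orders on the branches of a
   curve. Without it the Poincare series does not determine the filtration: if
   nu_2 is constantly oo then all Y v are empty, for any nu_1. *)
Definition proper_at_infinity : Prop :=
  forall i, finite_codim [set g : O | nu i g = None] ->
  forall j g, nu i g = None -> nu j g = None.

End Filtration.

(* Main.v *)
(* Since S_i has no largest element and codimensions are finite, every condition
   nu_i > s is equivalent to some nu_i >= t with t > s, so the codimension of
   {nu_i > v_i for i in A, nu_i >= v_i for the other i} is a minimum of values of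
   h.  PF_v is the complement of an arrangement of linear subspaces, and by
   inclusion-exclusion [PF_v] depends only on these codimensions: h determines
   P_g.

   Conversely, the coefficient of t^v in P_g is zero if Y_v is empty, and
   otherwise it starts with the term q^h(v); hence P_g determines the set of
   values of the filtration and h on it.  If J(v) contains, for each i, an element
   with nu_i finite, a generic element of J(v) has all its orders minimal, equal
   to some value w, and J(v) = J(w).  Otherwise properness at infinity forces J(v)
   to be the set of elements of infinite orders, and h(v) is read off the degrees
   of the coefficients of P_g. *)

Require Import Defs.
From HB Require Import structures.
From mathcomp Require Import all_boot all_order all_algebra.
From mathcomp Require Import ring_quotient generic_quotient complex.
From mathcomp Require Import -(notations) mpoly monalg.
From mathcomp Require Import all_classical all_reals.

Set Implicit Arguments.
Unset Strict Implicit.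
Unset Printing Implicit Defensive.

Import Order.TTheory GRing.Theory Num.Theory.

Local Open Scope classical_set_scope.
Local Open Scope ring_scope.
Local Open Scope complex_scope.
Local Open Scope quotient_scope.

(** * Classes of linear arrangements in the Grothendieck ring *)

Section GrothendieckRing.
Variable K : fieldType.

Lemma K0_rel_eq (a b : K0_free K) : K0_rel (a - b) ->
  \pi_(Quotient.quot (@K0_ideal K)) a = \pi_(Quotient.quot (@K0_ideal K)) b.
Proof. by move=> ab; apply/pzq_eqP/asboolP. Qed.

Lemma K0_class_iso d e (Z : qpvar K d) (W : qpvar K e) :
  isomorphic Z W -> K0_class Z = K0_class W.
Proof. by move=> ZW; apply/K0_rel_eq/K0_iso. Qed.

Lemma K0_class_cut d (Z Z' Z'' : qpvar K d) :
  closed_in Z' Z -> pts Z'' = pts Z `\` pts Z' ->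
  K0_class Z = K0_class Z' + K0_class Z''.
Proof.
move=> cl pZ; rewrite /K0_class.
transitivity (\pi_(Quotient.quot (@K0_ideal K)) (K0_gen Z' + K0_gen Z'')).
  exact/K0_rel_eq/K0_cut.
exact: raddfD.
Qed.

Lemma K0_class_prod d e (Z : qpvar K d) (W : qpvar K e) (P : qpvar K (d * e)) :
  pts P = segre Z W -> K0_class P = K0_class Z * K0_class W.
Proof.
move=> PE; transitivity (\pi_(Quotient.quot (@K0_ideal K)) (K0_gen Z * K0_gen W)).
  exact/K0_rel_eq/K0_prod.
exact: (pi_pzq_mul (@K0_ideal_mul K)).
Qed.

Lemma K0_class_point (P : qpvar K 1) :
  pts P = [set x | x != 0] -> K0_class P = 1.
Proof. by move=> PE; apply/K0_rel_eq/K0_point. Qed.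

Lemma pts_neq0 d (Z : qpvar K d) x : pts Z x -> x != 0.
Proof. by case: Z => p [fs [gs [_ _ pE]]] /=; rewrite pE => -[[]]. Qed.

(** The empty set is the disjoint union of two copies of itself, so its class is twice itself. *)
Lemma K0_class_empty d (Z : qpvar K d) : pts Z = set0 -> K0_class Z = 0.
Proof.
move=> Z0; apply: (@addrI _ (K0_class Z)); rewrite addr0; symmetry.
apply: K0_class_cut; last by rewrite Z0 set0D.
by exists [::] => //; rewrite Z0 set0I.
Qed.

Lemma proj_eq_refl d (x : 'rV[K]_d) : proj_eq x x.
Proof. by exists 1; rewrite ?oner_neq0 ?scale1r. Qed.

Lemma homogeneous1 d : homogeneous (1 : mpoly d K).
Proof. by exists 0%N; exact: dhomog1. Qed.

Lemma ev1 d (x : 'rV[K]_d) : ev 1 x = 1.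
Proof. exact: meval1. Qed.

Lemma evM d (p q : mpoly d K) x : ev (p * q) x = ev p x * ev q x.
Proof. exact: mevalM. Qed.

Lemma regular_forms d e (Z : qpvar K d) (W : qpvar K e) k
    (F : 'I_e -> mpoly d K) (f : 'rV[K]_d -> 'rV[K]_e) :
  (forall i, F i \is ishomog1 k mpoly.mdeg) ->
  (forall x, f x = \row_i ev (F i) x) ->
  (forall x, pts Z x -> pts W (f x)) -> regular Z W f.
Proof.
move=> Fk fE fZW; split=> // x Zx.
exists k, F, 1; split=> //; first exact: homogeneous1.
  by rewrite ev1 oner_neq0.
move=> y Zy _; rewrite -fE; split; last exact: proj_eq_refl.
exact/pts_neq0/fZW.
Qed.

Lemma coord_homog d (i : 'I_d) : mpolyX K (mpoly.mnm1 i) \is ishomog1 1 mpoly.mdeg.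
Proof. by rewrite dhomogX /= mpoly.mdeg1. Qed.

Lemma ev_coord d (i : 'I_d) (x : 'rV[K]_d) : ev (mpolyX K (mpoly.mnm1 i)) x = x 0 i.
Proof. exact: mevalXU. Qed.

Definition linform d (a : 'cV[K]_d) : mpoly d K :=
  \sum_i a i 0 *: mpolyX K (mpoly.mnm1 i).

Lemma linform_homog d (a : 'cV[K]_d) : linform a \is ishomog1 1 mpoly.mdeg.
Proof. by apply: rpred_sum => i _; apply/dhomogZ/coord_homog. Qed.

Lemma ev_linform d (a : 'cV[K]_d) x : ev (linform a) x = (x *m a) 0 0.
Proof.
rewrite /ev raddf_sum mxE; apply: eq_bigr => i _ /=.
by rewrite mevalZ mevalXU mulrC.
Qed.

Lemma regular_mulmx d e (Z : qpvar K d) (W : qpvar K e) (A : 'M[K]_(d, e)) :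
  (forall x, pts Z x -> pts W (x *m A)) -> regular Z W (mulmxr A).
Proof.
apply: (@regular_forms _ _ _ _ 1 (fun i => linform (col i A))).
  by move=> i; exact: linform_homog.
move=> x; apply/rowP => i; rewrite mxE ev_linform !mxE.
by apply: eq_bigr => j _; rewrite !mxE.
Qed.

Lemma isomorphic_pts d (Z W : qpvar K d) : pts Z = pts W -> isomorphic Z W.
Proof.
move=> ZW; exists (mulmxr 1%:M), (mulmxr 1%:M).
by split=> [||x _|x _]; try (apply: regular_mulmx => x);
  rewrite /= ?mulmx1 ?ZW //; exact: proj_eq_refl.
Qed.

Lemma K0_class_pts d (Z W : qpvar K d) : pts Z = pts W -> K0_class Z = K0_class W.
Proof. by move=> /isomorphic_pts/K0_class_iso. Qed.

(** The columns of [cokermx U] are linear equations of the row space of [U]. *)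
Definition eqns d (U : 'M[K]_d) : seq (mpoly d K) :=
  [seq linform (col j (cokermx U)) | j <- enum 'I_d].

Lemma eqns_homog d (U : 'M[K]_d) : homogeneous_seq (eqns U).
Proof. by move=> _ /mapP[j _ ->]; exists 1%N; exact: linform_homog. Qed.

Lemma zeros_eqns d (U : 'M[K]_d) x : zeros (eqns U) x <-> (x <= U)%MS.
Proof.
have evE j : ev (linform (col j (cokermx U))) x = (x *m cokermx U) 0 j.
  by rewrite ev_linform !mxE; apply: eq_bigr => k _; rewrite !mxE.
split=> [zU|].
  rewrite submxE; apply/eqP/rowP => j; rewrite -evE mxE; apply: zU.
  by apply/mapP; exists j; rewrite ?mem_enum.
by rewrite submxE => /eqP xU _ /mapP[j _ ->]; rewrite evE xU mxE.
Qed.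

Definition arr_set d (W : 'M[K]_d) (Us : seq 'M[K]_d) : set 'rV[K]_d :=
  [set x | [/\ x != 0, (x <= W)%MS & all (fun U => ~~ (x <= U)%MS) Us]].

(* One equation is chosen from each [U]: the common zeros of all such products
   form the union of the [U]s. *)
Definition union_eqns d (Us : seq 'M[K]_d) : seq (mpoly d K) :=
  foldr (fun U gs => [seq p * q | p <- eqns U, q <- gs]) [:: 1] Us.

Lemma union_eqns_homog d (Us : seq 'M[K]_d) : homogeneous_seq (union_eqns Us).
Proof.
elim: Us => [|U Us IH] f /=; first by rewrite inE => /eqP->; exact: homogeneous1.
move=> /allpairsP[[p q] /= [/eqns_homog[j pj] /IH[k qk] ->]].
by exists (j + k)%N; exact: dhomogM.
Qed.

Lemma zeros_union_eqns d (Us : seq 'M[K]_d) x :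
  ~ zeros (union_eqns Us) x <-> all (fun U => ~~ (x <= U)%MS) Us.
Proof.
elim: Us => [|U Us IH] /=.
  split=> // _ /(_ 1); rewrite inE eqxx ev1 => /(_ isT) /eqP.
  by rewrite oner_eq0.
split=> [nz|/andP[xU /IH xUs]].
  apply/andP; split.
    apply/negP => /zeros_eqns zU; apply: nz => _ /allpairsP[[p q] /= [pU _ ->]].
    by rewrite evM (zU p pU) mul0r.
  apply/IH => zUs; apply: nz => _ /allpairsP[[p q] /= [_ qUs ->]].
  by rewrite evM (zUs q qUs) mulr0.
move=> z; apply: xUs => q qUs; apply: contrapT => /eqP q0.
move/negP: xU; apply; apply/zeros_eqns => p pU.
have /eqP := z _ (allpairs_f (fun p q => p * q) pU qUs).
by rewrite evM mulf_eq0 (negbTE q0) orbF => /eqP.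
Qed.

Fact arrangement_subproof d (W : 'M[K]_d) (Us : seq 'M[K]_d) : exists fs gs,
  [/\ homogeneous_seq fs, homogeneous_seq gs &
      arr_set W Us = [set x | x != 0 /\ zeros fs x] `\` zeros gs].
Proof.
exists (eqns W), (union_eqns Us); split.
- exact: eqns_homog.
- exact: union_eqns_homog.
apply/seteqP; split=> x /=.
  by move=> [x0 /zeros_eqns xW /zeros_union_eqns xUs].
by move=> [[x0 /zeros_eqns xW] /zeros_union_eqns xUs].
Qed.

Definition arrangement d (W : 'M[K]_d) Us := QPVar (arrangement_subproof W Us).

(** Deletion and restriction: the part that [U] removes is closed, and is itself an arrangement
    inside [W :&: U]. *)
Lemma arrangement_cut d (W U : 'M[K]_d) Us :
  K0_class (arrangement W Us) =
  K0_class (arrangement (W :&: U)%MS Us) + K0_class (arrangement W (U :: Us)).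
Proof.
apply: K0_class_cut.
  exists (eqns U); first exact: eqns_homog.
  apply/seteqP; split=> x /=; rewrite /arr_set /= sub_capmx.
    by move=> [x0 /andP[xW xU] xUs]; split=> //; apply/zeros_eqns.
  by move=> [[x0 xW xUs] /zeros_eqns xU]; split=> //; apply/andP.
apply/seteqP; split=> x /=; rewrite /arr_set /= sub_capmx.
  move=> [x0 xW /andP[xU xUs]]; split=> // -[_ /andP[_ xU']].
  by rewrite xU' in xU.
move=> [[x0 xW xUs] nx]; split=> //; rewrite xUs andbT; apply/negP => xU.
by apply: nx; split=> //; rewrite xW.
Qed.

(** * Projective spaces, affine spaces and powers of the line *)

Definition proj_space k : qpvar K k := arrangement 1%:M [::].

(** Multiplication by [W] and by [pinvmx W] are inverse linear maps between the coordinate space and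
    the row space of [W]. *)
Lemma K0_class_free k d (W : 'M[K]_(k, d)) (Z : qpvar K d) : row_free W ->
  pts Z = [set x | x != 0 /\ (x <= W)%MS] -> K0_class Z = K0_class (proj_space k).
Proof.
move=> freeW ZE; apply: K0_class_iso; exists (mulmxr (pinvmx W)), (mulmxr W).
have inj (y : 'rV[K]_k) : (y *m W == 0) = (y == 0).
  by rewrite -(inj_eq (row_free_inj freeW)) mul0mx.
split=> [||x|y _] /=.
- apply: regular_mulmx => x; rewrite ZE => -[x0 xW]; split=> //.
    by apply: contraNneq x0 => xp0; rewrite -(mulmxKpV xW) xp0 mul0mx.
  exact: submx1.
- apply: regular_mulmx => y [y0 _ _]; rewrite ZE /=.
  by rewrite inj y0 submxMl.
- by rewrite ZE => -[_ xW]; rewrite mulmxKpV //; exact: proj_eq_refl.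
- by rewrite mulmxKp //; exact: proj_eq_refl.
Qed.

Lemma K0_class_linear d (W : 'M[K]_d) :
  K0_class (arrangement W [::]) = K0_class (proj_space (\rank W)).
Proof.
apply: (K0_class_free (row_base_free W)).
by apply/seteqP; split=> x /=; rewrite /arr_set /= eq_row_base => -[].
Qed.

Definition hyperplane k : 'M[K]_(k, 1 + k) := row_mx 0 1%:M.

Lemma hyperplaneP k (x : 'rV[K]_(1 + k)) : (x <= hyperplane k)%MS = (x 0 0 == 0).
Proof.
apply/submxP/eqP => [[y ->]|x0].
  by rewrite mul_mx_row mulmx0 mxE; case: splitP => // j _; rewrite mxE.
exists (rsubmx x); rewrite mul_mx_row mulmx0 mulmx1 -[LHS]hsubmxK.
congr row_mx; apply/rowP => i; rewrite !mxE -[RHS]x0; congr (x _ _).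
by apply/val_inj; rewrite /= (ord1 i).
Qed.

Lemma hyperplane_free k : row_free (hyperplane k).
Proof.
apply/row_freeP; exists (col_mx 0 1%:M).
by rewrite mul_row_col mulmx0 mulmx1 add0r.
Qed.

Definition affine_space k : qpvar K (1 + k) :=
  arrangement 1%:M [:: <<hyperplane k>>%MS].

Lemma pts_affine_space k : pts (affine_space k) = [set x | x 0 0 != 0].
Proof.
apply/seteqP; split=> x /=; rewrite /arr_set /= genmxE hyperplaneP andbT.
  by case.
move=> x00; split=> //; last exact: submx1.
by apply: contraNneq x00 => ->; rewrite mxE.
Qed.

(** Cell decomposition: the hyperplane x_0 = 0 is a projective space of one dimension less, and its
    complement is affine. *)
Lemma proj_space_cut k : K0_class (proj_space (1 + k)) =
  K0_class (proj_space k) + K0_class (affine_space k).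
Proof.
have <- : K0_class (arrangement (1%:M :&: <<hyperplane k>>)%MS [::]) =
    K0_class (proj_space k).
  apply: (K0_class_free (hyperplane_free k)).
  apply/seteqP; split=> x /=; rewrite /arr_set /= sub_capmx submx1 genmxE /=.
    by case.
  by case.
exact: arrangement_cut.
Qed.

(** The product consists of the rank one matrices with nonzero corner entry; the minors through this
    pivot already force rank one. *)
Lemma segre_affineE k : segre (affine_space k) (affine_line K) =
  [set x | vec_mx x 0 0 != 0 /\ forall i,
     vec_mx x 0 0 * vec_mx x i 1 - vec_mx x i 0 * vec_mx x 0 1 = 0].
Proof.
apply/seteqP; split=> x.
  move=> [z [w [Zz Ww ->]]]; move: Zz; rewrite pts_affine_space /= => z0.
  rewrite /= mxvecK; split.
    by rewrite !mxE big_ord1 !mxE mulf_neq0.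
  move=> i; rewrite !mxE !big_ord1 !mxE.
  by rewrite mulrACA [X in _ - X]mulrACA [z 0 0 * _]mulrC subrr.
rewrite /=; move: (vec_mxK x); move: (vec_mx x) => M <- [M0 Mm].
(* The first column times the first row, divided by the pivot, gives back [M]. *)
exists (\row_i M i 0), (\row_j (M 0 j / M 0 0)); rewrite pts_affine_space.
split; first by rewrite /= mxE.
  by rewrite /= mxE divff ?oner_neq0.
congr mxvec; apply/matrixP => i j; rewrite !mxE big_ord1 !mxE.
case: (unliftP 0 j) => [j'|] ->; last by rewrite divff ?mulr1.
rewrite (ord1 j') (_ : lift 0 0 = 1 :> 'I_2); last exact: val_inj.
by rewrite mulrA -(subr0_eq (Mm i)) mulrAC divff // mul1r.
Qed.

Fact segre_affine_subproof k : exists fs gs : seq (mpoly ((1 + k) * 2) K),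
  [/\ homogeneous_seq fs, homogeneous_seq gs &
    segre (affine_space k) (affine_line K) =
    [set x | x != 0 /\ zeros fs x] `\` zeros gs].
Proof.
pose Xc (i : 'I_(1 + k)) (j : 'I_2) := mpolyX K (mpoly.mnm1 (mxvec_index i j)).
have evX i j x : ev (Xc i j) x = vec_mx x i j.
  by rewrite ev_coord -[x in LHS]vec_mxK mxvecE.
exists [seq Xc 0 0 * Xc i 1 - Xc i 0 * Xc 0 1 | i <- enum 'I_(1 + k)],
  [:: Xc 0 0].
have evm i x : ev (Xc 0 0 * Xc i 1 - Xc i 0 * Xc 0 1) x =
    vec_mx x 0 0 * vec_mx x i 1 - vec_mx x i 0 * vec_mx x 0 1.
  by rewrite -!evX; exact: (etrans (mevalB _ _ _) (congr2 _ (evM _ _ _)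
       (congr1 _ (evM _ _ _)))).
split.
- move=> _ /mapP[i _ ->]; exists 2%N; apply: rpredB;
    exact: (dhomogM (coord_homog _) (coord_homog _)).
- by move=> _ /[!inE] /eqP ->; exists 1%N; exact: coord_homog.
rewrite segre_affineE; apply/seteqP; split=> x /=.
  move=> [x0 xm]; split; first split.
  - by apply: contraNneq x0 => ->; rewrite linear0 mxE.
  - by move=> _ /mapP[i _ ->]; rewrite evm.
  - move=> /(_ _ (mem_head _ _)); rewrite evX => /eqP.
    by rewrite (negbTE x0).
move=> [[_ xm] x0]; split.
  by apply/eqP => z; apply: x0 => _ /[!inE] /eqP ->; rewrite evX.
by move=> i; rewrite -evm; apply/xm/mapP; exists i; rewrite ?mem_enum.
Qed.

Definition segre_affine k := QPVar (segre_affine_subproof k).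

Lemma segre_affine_iso k : isomorphic (segre_affine k) (affine_space k.+1).
Proof.
(* [f] keeps the first column and puts the remaining entry of the first row last; [g] multiplies
   this column by the pair of the first and last coordinates. *)
pose m : 'I_(1 + k.+1) := ord_max.
pose f (x : 'rV[K]_((1 + k) * 2)) : 'rV[K]_(1 + k.+1) :=
  \row_j if unlift m j is Some i then vec_mx x i 0 else vec_mx x 0 1.
pose w (j : 'I_2) : 'I_(1 + k.+1) := if j == 0 then 0 else m.
pose g (y : 'rV[K]_(1 + k.+1)) : 'rV[K]_((1 + k) * 2) :=
  mxvec (\matrix_(i, j) (y 0 (lift m i) * y 0 (w j))).
have m0 : lift m (0 : 'I_(1 + k)) = 0 by apply/val_inj.
have fl x i : f x 0 (lift m i) = vec_mx x i 0 by rewrite [LHS]mxE liftK.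
have fm x : f x 0 m = vec_mx x 0 1 by rewrite [LHS]mxE unlift_none.
have f00 x : f x 0 0 = vec_mx x 0 0 by rewrite -m0 fl.
have evX i j x : ev (mpolyX K (mpoly.mnm1 (mxvec_index i j))) x = vec_mx x i j.
  by rewrite ev_coord -[x in LHS]vec_mxK mxvecE.
have PE : pts (segre_affine k) = _ := segre_affineE k.
exists f, g; split.
- apply: (@regular_forms _ _ _ _ 1 (fun j => mpolyX K (mnm1
    (if unlift m j is Some i then mxvec_index i 0 else mxvec_index 0 1)))).
  + by move=> j; exact: coord_homog.
  + by move=> x; apply/rowP => j; rewrite [LHS]mxE [RHS]mxE; case: unlift => [i|];
      rewrite evX.
  + by move=> x; rewrite PE pts_affine_space /= f00 => -[].
- apply: (@regular_forms _ _ _ _ 2 (fun l => (mxvec (\matrix_(i, j)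
    (mpolyX K (mpoly.mnm1 (lift m i)) * mpolyX K (mpoly.mnm1 (w j))))) 0 l)).
  + move=> l; case/mxvec_indexP: l => i j; rewrite mxvecE mxE.
    exact: (dhomogM (coord_homog _) (coord_homog _)).
  + move=> y; apply/rowP => l; case/mxvec_indexP: l => i j.
    by rewrite mxE !mxvecE !mxE evM !ev_coord.
  + move=> y; rewrite PE pts_affine_space /= mxvecK => y0; split.
      by rewrite !mxE m0 mulf_neq0.
    move=> i; rewrite !mxE m0 /w /=.
    by rewrite [X in _ - X]mulrACA mulrACA [y 0 0 * y 0 (lift _ _)]mulrC subrr.
(* By the vanishing minors, [g (f x)] is [x] scaled by its corner entry. *)
- move=> x; rewrite PE /= => -[x0 xm]; exists (vec_mx x 0 0) => //.
  rewrite /g -[RHS]vec_mxK linearZ; congr mxvec; apply/matrixP => i j.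
  rewrite [LHS]mxE fl [RHS]mxE /w; case: (unliftP 0 j) => [j'|] ->; last first.
    by rewrite eqxx f00 mulrC.
  rewrite (ord1 j') (_ : lift 0 0 = 1 :> 'I_2); last exact: val_inj.
  by rewrite /= fm (subr0_eq (xm i)).
- move=> y; rewrite pts_affine_space /= => y0; exists (y 0 0) => //.
  apply/rowP => j; rewrite [RHS]mxE; case: (unliftP m j) => [i|] ->.
    by rewrite fl mxvecK mxE mulrC.
  by rewrite fm mxvecK mxE m0.
Qed.

Lemma K0_class_affine_space k : K0_class (affine_space k) = K0_L K ^+ k.
Proof.
elim: k => [|k IH].
  rewrite expr0; apply: K0_class_point.
  rewrite pts_affine_space; apply/seteqP; split=> x /=; apply: contraNneq.
    by move=> ->; rewrite mxE.
  by move=> x0; apply/eqP/rowP => i; rewrite (ord1 i) mxE.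
rewrite -(K0_class_iso (segre_affine_iso k)) (@K0_class_prod _ _ (affine_space k)
  (affine_line K)) // IH exprSr //.
Qed.

Lemma K0_class_proj_space k :
  K0_class (proj_space k) = \sum_(j < k) K0_L K ^+ j.
Proof.
elim: k => [|k IH]; last first.
  by rewrite big_ord_recr /= -IH proj_space_cut K0_class_affine_space.
rewrite big_ord0; apply: K0_class_empty; apply/seteqP; split=> x //= -[].
by rewrite thinmx0 eqxx.
Qed.

Lemma K0_polyE n (p : {poly int}) : (size p <= n)%N ->
  K0_poly K p = \sum_(k < n) K0_L K ^+ k *~ p`_k.
Proof.
move=> pn; rewrite /K0_poly (big_ord_widen n (fun k => K0_L K ^+ k *~ p`_k)) //.
rewrite big_mkcond; apply: eq_bigr => i _; case: ifPn => //.
by rewrite -leqNgt => pi; rewrite nth_default // mulr0z.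
Qed.

Lemma K0_polyB p q : K0_poly K (p - q) = K0_poly K p - K0_poly K q.
Proof.
pose n := maxn (size p) (size q).
rewrite (@K0_polyE n p) ?(@K0_polyE n q) ?leq_maxl ?leq_maxr //.
rewrite (@K0_polyE n); last first.
  by rewrite (leq_trans (size_polyD _ _)) // size_polyN.
by rewrite -sumrB; apply: eq_bigr => i _; rewrite coefB mulrzBr.
Qed.

Lemma K0_poly0 : K0_poly K 0 = 0.
Proof. by rewrite /K0_poly size_poly0 big_ord0. Qed.

(* The class of P^(k-1) as a polynomial in L. *)
Definition geom_poly k : {poly int} := \poly_(j < k) 1.

Lemma K0_poly_geom k : K0_poly K (geom_poly k) = K0_class (proj_space k).
Proof.
rewrite (@K0_polyE k) ?size_poly // K0_class_proj_space.
by apply: eq_bigr => i _; rewrite coef_poly ltn_ord.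
Qed.

(** The recursion of [arrangement_cut], solved for the complement. *)
Fixpoint arr_poly d (W : 'M[K]_d) (Us : seq 'M[K]_d) : {poly int} :=
  if Us is U :: Us' then arr_poly W Us' - arr_poly (W :&: U)%MS Us'
  else geom_poly (\rank W).

Lemma K0_class_arrangement d (W : 'M[K]_d) Us :
  K0_class (arrangement W Us) = K0_poly K (arr_poly W Us).
Proof.
elim: Us W => [|U Us IH] W /=; first by rewrite K0_poly_geom K0_class_linear.
rewrite K0_polyB -(IH W) -(IH (W :&: U)%MS); apply: (canRL (addrK _)).
by rewrite addrC; exact/esym/arrangement_cut.
Qed.

End GrothendieckRing.
(** * Subspaces of finite codimension *)

Section FiniteCodimension.
Variables (K : fieldType) (E : lmodType K).
Implicit Types A B : set E.

Definition subspace (V : lmodType K) (A : set V) :=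
  A 0 /\ forall a x y, A x -> A y -> A (a *: x + y).

Lemma subspaceD A x y : subspace A -> A x -> A y -> A (x + y).
Proof. by move=> [_ sA] Ax Ay; rewrite -[x]scale1r; exact: sA. Qed.

Lemma subspaceZ A a x : subspace A -> A x -> A (a *: x).
Proof. by move=> [A0 sA] Ax; rewrite -[_ *: _]addr0; exact: sA. Qed.

Lemma subspaceB A x y : subspace A -> A x -> A y -> A (x - y).
Proof.
by move=> sA Ax Ay; apply: subspaceD => //; rewrite -scaleN1r; exact: subspaceZ.
Qed.

Lemma subspace_congr A x y : subspace A -> A (x - y) -> A x <-> A y.
Proof.
move=> sA Axy; split=> Ax; last by rewrite -(subrK y x); exact: subspaceD.
by rewrite -(subKr x y); exact: subspaceB.
Qed.

Definition lincomb m (e : 'I_m -> E) (c : 'rV[K]_m) : E := \sum_i c 0 i *: e i.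

Lemma lincomb_is_linear m (e : 'I_m -> E) a c c' :
  lincomb e (a *: c + c') = a *: lincomb e c + lincomb e c'.
Proof.
rewrite /lincomb scaler_sumr -big_split; apply: eq_bigr => i _ /=.
by rewrite !mxE scalerDl scalerA.
Qed.

Lemma lincomb0 m (e : 'I_m -> E) : lincomb e 0 = 0.
Proof. by rewrite /lincomb big1 // => i _; rewrite mxE scale0r. Qed.

Lemma lincombB m (e : 'I_m -> E) c c' :
  lincomb e (c - c') = lincomb e c - lincomb e c'.
Proof. by rewrite [c - _]addrC -(scaleN1r c') lincomb_is_linear scaleN1r addrC. Qed.

Lemma lincomb_sub A m (e : 'I_m -> E) c :
  subspace A -> (forall i, A (e i)) -> A (lincomb e c).
Proof.
move=> sA Ae; apply: (big_ind A) => [|x y|i _]; first by case: sA.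
  exact: subspaceD.
exact: subspaceZ.
Qed.

Lemma lincomb_mulmx m k (e : 'I_m -> E) (M : 'M[K]_(k, m)) u :
  lincomb e (u *m M) = lincomb (fun j => lincomb e (row j M)) u.
Proof.
rewrite /lincomb; under [RHS]eq_bigr => j _ do rewrite scaler_sumr.
rewrite exchange_big; apply: eq_bigr => i _ /=; rewrite mxE scaler_suml.
by apply: eq_bigr => j _; rewrite scalerA mxE.
Qed.

(** Among the matrices whose row space lies in [P], one of maximal rank works: adjoining a vector of
    [P] cannot raise its rank. *)
Lemma subspace_mx m (P : set 'rV[K]_m) : subspace P ->
  exists W : 'M[K]_m, forall c, (c <= W)%MS <-> P c.
Proof.
move=> sP; pose ok (W : 'M[K]_m) := forall c : 'rV_m, (c <= W)%MS -> P c.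
have ex_k : exists k, `[< exists2 W, ok W & \rank W = k >].
  exists 0%N; apply/asboolP; exists 0; last by rewrite mxrank0.
  by move=> c; rewrite submx0 => /eqP ->; case: sP.
have le_k k : `[< exists2 W, ok W & \rank W = k >] -> (k <= m)%N.
  by move=> /asboolP[W _ <-]; exact: rank_leq_row.
have [k /asboolP[W okW <-] maxW] := ex_maxnP ex_k le_k.
exists W => c; split=> [|Pc]; first exact: okW.
have okWc : ok (W + c)%MS.
  move=> x /sub_addsmxP[[u v] /= ->]; rewrite addrC.
  rewrite [v]mx11_scalar mul_scalar_mx; apply sP => //.
  by apply: okW; exact: submxMl.
have /maxW le_r : `[< exists2 W', ok W' & \rank W' = \rank (W + c)%MS >].
  by apply/asboolP; exists (W + c)%MS.
have : (W + c <= W)%MS by rewrite -(geq_leqif (mxrank_leqif_sup (addsmxSl W c))).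
by apply: submx_trans; exact: addsmxSr.
Qed.

(** In the coordinates given by [e], [A'] becomes a row space, and a basis of it lifts to one of
    A'/B. The matrix [W] is kept so that its rank can be compared with codimensions. *)
Lemma basis_mod_sub A A' B m (e : 'I_m -> E) :
  basis_mod A B e -> subspace A' -> subspace B -> B `<=` A' -> A' `<=` A ->
  exists W : 'M[K]_m, (forall c, (c <= W)%MS <-> A' (lincomb e c)) /\
    basis_mod A' B (fun j => lincomb e (row j (row_base W))).
Proof.
move=> [Ae genA indA] sA' sB BA' A'A.
have [|W WP] := @subspace_mx m [set c | A' (lincomb e c)].
  split=> [|a x y] /=; first by rewrite lincomb0; case: sA'.
  by rewrite lincomb_is_linear; apply sA'.
exists W; split=> //; split=> [i|g A'g|c].
- by apply/WP; rewrite (submx_trans (row_sub _ _)) ?eq_row_base.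
- have [c Bc] := genA g (A'A g A'g).
  have /WP cW : A' (lincomb e c) by apply/(subspace_congr sA' (BA' _ Bc)).
  move: cW; rewrite -(eq_row_base W) => /submxP[u cu]; exists u.
  by rewrite -[X in B (g - X)]/(lincomb _ u) -lincomb_mulmx -cu.
- rewrite -[X in B X]/(lincomb _ c) -lincomb_mulmx => /indA /eqP.
  by rewrite mulmx_free_eq0 ?row_base_free // => /eqP.
Qed.

(** Write [f] in terms of [e] modulo [B]: a relation between the rows of coefficients would put a
    combination of [f] in [B], so the rows are independent. *)
Lemma basis_mod_leq A B m (e : 'I_m -> E) k (f : 'I_k -> E) :
  subspace B -> basis_mod A B e -> basis_mod A B f -> (k <= m)%N.
Proof.
move=> sB [_ genA _] [Af _ indA].
have [M MP] := choice (fun j => genA (f j) (Af j)).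
suff /eqP <- : row_free (\matrix_j M j) by exact: rank_leq_col.
apply/inj_row_free => u uM; apply: indA; rewrite -[X in B X]/(lincomb f u).
have -> : lincomb f u = lincomb (fun j => f j - lincomb e (M j)) u.
  rewrite -[LHS]subr0 -(lincomb0 e) -uM lincomb_mulmx /lincomb -sumrB.
  by apply: eq_bigr => j _; rewrite rowK scalerBr.
exact: lincomb_sub.
Qed.

Lemma basis_mod_size A B m (e : 'I_m -> E) k (f : 'I_k -> E) :
  subspace B -> basis_mod A B e -> basis_mod A B f -> k = m.
Proof.
move=> sB be bf; apply/eqP; rewrite eqn_leq.
by rewrite (basis_mod_leq sB be bf) (basis_mod_leq sB bf be).
Qed.

Lemma codimE B m (e : 'I_m -> E) :
  subspace B -> basis_mod setT B e -> codim B = m.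
Proof.
(* The default value of [xget] is excluded, as [m] lies in the set. *)
move=> sB be; rewrite /codim; case: xgetP => [k _ [f bf]|]; last first.
  by move=> /(_ m); case; exists e.
exact: basis_mod_size be bf.
Qed.

(** Additivity of dimensions. For independence, reducing modulo [A] kills the coordinates along [f],
    and those along [e] then vanish modulo [B]. *)
Lemma basis_mod_cat C A B m (e : 'I_m -> E) k (f : 'I_k -> E) :
  subspace A -> subspace C -> B `<=` A -> A `<=` C ->
  basis_mod C A f -> basis_mod A B e ->
  basis_mod C B
    (fun i => match fintype.split i with inl j => f j | inr j => e j end).
Proof.
move=> sA sC BA AC [Cf genf indf] [Ae gene inde]; set h := (fun i => _).
have hE (c : 'rV[K]_(k + m)) :
    lincomb h c = lincomb f (lsubmx c) + lincomb e (rsubmx c).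
  rewrite /lincomb big_split_ord; congr (_ + _); apply: eq_bigr => j _.
    by rewrite /h (unsplitK (inl j)) !mxE.
  by rewrite /h (unsplitK (inr j)) !mxE.
split=> [i|g Cg|c].
- by rewrite /h; case: fintype.split => j //; exact/AC/Ae.
- have [u Au] := genf g Cg; have [v Bv] := gene _ Au.
  exists (row_mx u v); rewrite -[X in g - X]/(lincomb h _) hE.
  by rewrite row_mxKl row_mxKr opprD addrA.
- rewrite -[X in B X]/(lincomb h _) hE => Bc.
  have Ae' : A (lincomb e (rsubmx c)) by exact: lincomb_sub.
  have l0 : lsubmx c = 0.
    apply: indf; rewrite -[X in A X]/(lincomb f _).
    rewrite -[X in A X](addrK (lincomb e (rsubmx c))).
    by apply: subspaceB => //; exact: BA.
  have r0 : rsubmx c = 0.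
    by apply: inde; move: Bc; rewrite l0 lincomb0 add0r.
  by rewrite -[c]hsubmxK l0 r0 row_mx0.
Qed.

Lemma codim_basis_mod A B m (e : 'I_m -> E) :
  subspace A -> subspace B -> B `<=` A -> finite_codim A -> basis_mod A B e ->
  codim B = (codim A + m)%N.
Proof.
move=> sA sB BA [k [f bf]] be; rewrite (codimE sA bf); apply: codimE => //.
by apply: (basis_mod_cat _ _ BA _ bf be) => //; split.
Qed.

Lemma finite_basis_mod A B :
  subspace A -> subspace B -> B `<=` A -> finite_codim B ->
  exists m (e : 'I_m -> E), basis_mod A B e.
Proof.
move=> sA sB BA [k [f bf]].
have [W [_ be]] := basis_mod_sub bf sA sB BA (@subsetT _ A).
by exists (\rank W); eexists; exact: be.
Qed.

Lemma codimS A B : subspace A -> subspace B -> finite_codim A ->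
  finite_codim B -> B `<=` A -> (codim A <= codim B)%N.
Proof.
move=> sA sB fA fB BA; have [m [e be]] := finite_basis_mod sA sB BA fB.
by rewrite (codim_basis_mod sA sB BA fA be) leq_addr.
Qed.

Lemma codim_eq A B : subspace A -> subspace B -> finite_codim A ->
  finite_codim B -> B `<=` A -> (codim B <= codim A)%N -> A = B.
Proof.
move=> sA sB fA fB BA; have [m [e be]] := finite_basis_mod sA sB BA fB.
rewrite (codim_basis_mod sA sB BA fA be) -{2}[codim A]addn0 leq_add2l leqn0.
move=> /eqP m0; apply/seteqP; split=> // g Ag; case: be => _ /(_ g Ag) [c].
by subst m; rewrite big_ord0 subr0.
Qed.

(** The family [e] still spans modulo [B] but may become dependent; combinations with coefficients
    in a complement of the relations [W] give a basis. *)
Lemma finite_codimS A B : subspace B -> A `<=` B -> finite_codim A -> finite_codim B.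
Proof.
move=> sB AB [m [e [_ gene _]]].
have [|W WP] := @subspace_mx m [set c | B (lincomb e c)].
  split=> [|a x y] /=; first by rewrite lincomb0; case: sB.
  by rewrite lincomb_is_linear; apply sB.
exists (\rank (W^C)%MS), (fun j => lincomb e (row j (row_base (W^C)%MS))).
split=> // [g _|c].
  have [c /AB Bc] := gene g I.
  have /sub_addsmxP[[u1 u2] /= cE] : (c <= W + W^C)%MS.
    by rewrite submx_full // addsmx_compl_full.
  have : (u2 *m (W^C)%MS <= row_base (W^C)%MS)%MS by rewrite eq_row_base submxMl.
  move=> /submxP[u uE]; exists u.
  rewrite -[X in g - X]/(lincomb _ u) -lincomb_mulmx -uE.
  have -> : u2 *m (W^C)%MS = c - u1 *m W by rewrite cE addrAC subrr add0r.
  rewrite lincombB opprB addrCA addrC; apply: subspaceD => //.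
  by apply/WP; exact: submxMl.
rewrite -[X in B X]/(lincomb _ c) -lincomb_mulmx => /WP cW.
have : (c *m row_base (W^C)%MS <= W :&: W^C)%MS.
  by rewrite sub_capmx cW -(eq_row_base (W^C)%MS) submxMl.
rewrite capmx_compl submx0 mulmx_free_eq0 ?row_base_free // => /eqP.
by [].
Qed.

End FiniteCodimension.

(** * Elements outside finitely many subspaces *)

Section Avoidance.
Variables (K : numFieldType) (E : lmodType K) (I : eqType) (U : I -> set E).
Hypothesis sU : forall i, subspace (U i).

(** A line whose direction is outside [U i] meets [U i] at most once, and integers are distinct in
    characteristic zero. *)
Lemma line_avoid (x y : E) (s : seq I) : {in s, forall i, ~ U i x} ->
  exists N, forall t, (N <= t)%N -> {in s, forall i, ~ U i (y + t%:R *: x)}.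
Proof.
elim: s => [|i s IH] Ux; first by exists 0%N.
have [|N NP] := IH; first by move=> j js; apply: Ux; rewrite inE js orbT.
have [M MP] : exists M, forall t, (M <= t)%N -> ~ U i (y + t%:R *: x).
  have [[t0 Ut0]|nU] := pselect (exists t0, U i (y + t0%:R *: x)); last first.
    by exists 0%N => t _ Ut; apply: nU; exists t.
  exists t0.+1 => t t0t Ut; apply: (Ux i (mem_head _ _)).
  have nz : (t%:R - t0%:R : K) != 0.
    by rewrite subr_eq0 eqr_nat gtn_eqF.
  rewrite -[x](scalerK nz); apply: subspaceZ => //.
  have -> : (t%:R - t0%:R) *: x = (y + t%:R *: x) - (y + t0%:R *: x).
    by rewrite scalerBl opprD addrACA subrr add0r.
  exact: subspaceB.
exists (maxn M N) => t; rewrite geq_max => /andP[Mt Nt] j.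
by rewrite inE => /orP[/eqP -> |]; [exact: MP | exact: NP].
Qed.

Lemma subspace_avoid (A : set E) (s : seq I) : subspace A ->
  {in s, forall i, exists2 g, A g & ~ U i g} ->
  exists2 g, A g & {in s, forall i, ~ U i g}.
Proof.
move=> sA; elim: s => [|i s IH] Us; first by exists 0 => //; case: sA.
have [|g Ag gP] := IH; first by move=> j js; apply: Us; rewrite inE js orbT.
have [f Af Uf] := Us i (mem_head _ _).
have [Ug|nUg] := pselect (U i g); last first.
  by exists g => // j; rewrite inE => /orP[/eqP -> |] //; exact: gP.
have [N NP] := line_avoid f gP.
(* As [g] is in [U i] and [f] is not, the sum is outside [U i] for any multiple of [g]; a large
   multiple keeps it out of the other subspaces. *)
exists (f + N%:R *: g); first by apply: subspaceD => //; exact: subspaceZ.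
move=> j; rewrite inE => /orP[/eqP -> Ufg|]; last exact: NP.
apply: Uf; rewrite -(addrK (N%:R *: g) f).
by apply: subspaceB => //; exact: subspaceZ.
Qed.

End Avoidance.
(** * Inclusion-exclusion polynomials *)

Section InclusionExclusion.
Variables (I : finType) (D : {set I} -> nat).
Implicit Types (s : seq I) (A B : {set I}).

(* The sum over the subsets B of s of (-1)^|B| [P^(D (A :|: B) - 1)]. *)
Fixpoint incl_excl s A : {poly int} :=
  if s is i :: s' then incl_excl s' A - incl_excl s' (i |: A)
  else geom_poly (D A).

Lemma size_incl_excl s A k :
  (forall B, A \subset B -> D B <= k)%N -> (size (incl_excl s A) <= k)%N.
Proof.
elim: s A => [|i s IH] A Dk /=.
  by apply: leq_trans (size_poly _ _) _; exact: Dk.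
apply: leq_trans (size_polyD _ _) _; rewrite size_polyN geq_max IH //=.
by apply: IH => B AB; apply: Dk; apply: fintype.subset_trans AB; exact: finset.subsetUr.
Qed.

(** The terms of proper supersets of [A] have degree less than [k], so only the term of [A] itself
    contributes. *)
Lemma coef_incl_excl s A k : {in s, forall i, i \notin A} -> (k < D A)%N ->
  (forall B, A \proper B -> D B <= k)%N -> (incl_excl s A)`_k = 1.
Proof.
move=> + kA Dk; elim: s => [|i s IH] sA /=; first by rewrite coef_poly kA.
rewrite coefB IH => [|j js]; last by apply: sA; rewrite inE js orbT.
rewrite [X in _ - X]nth_default ?subr0 //; apply: size_incl_excl => B iAB.
apply: Dk; apply: proper_sub_trans iAB; rewrite properUr //.
by rewrite finset.sub1set sA ?mem_head.
Qed.

(** The subtraction is truncated, but [size p <= h] makes it an involution of the indices below [h],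
    so that no two terms collide. *)
Lemma coef_reversed (p : {poly int}) h j : (size p <= h)%N ->
  (\sum_(k < size p) p`_k *: 'X^(h.-1 - k))`_j =
  if (j < h)%N then p`_(h.-1 - j) else 0.
Proof.
move=> ph; have [->|p0] := eqVneq p 0.
  by rewrite size_poly0 big_ord0 !coef0 if_same.
have h0 : (0 < h)%N by rewrite (leq_trans _ ph) ?size_poly_gt0.
rewrite (big_ord_widen h (fun k => p`_k *: 'X^(h.-1 - k))) //.
rewrite big_mkcond coef_sum /=.
under eq_bigr => k _.
  have -> : (if (k < size p)%N then p`_k *: 'X^(h.-1 - k) else 0)`_j =
            (if j == (h.-1 - k)%N then p`_k else 0).
    case: ifPn => [_|]; first by rewrite coefZ coefXn; case: eqP; rewrite ?mulr1 ?mulr0.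
    by rewrite -leqNgt coef0 => pk; rewrite nth_default ?if_same.
  over.
rewrite -big_mkcond /=; case: ltnP => jh.
  have lt : (h.-1 - j < h)%N by rewrite -{2}(prednK h0) ltnS leq_subr.
  rewrite (big_pred1 (Ordinal lt)) // => k /=; apply/eqP/eqP => [jE|->] /=.
    by apply/val_inj; rewrite /= jE subKn // -ltnS prednK.
  by rewrite subKn // -ltnS prednK.
rewrite big_pred0 // => k; apply/negP => /eqP jE; move: jh.
by rewrite jE leqNgt (leq_ltn_trans (leq_subr _ _)) // ltn_predL.
Qed.

End InclusionExclusion.
(** * Multi-index filtrations *)

Lemma oo_leE d (T : orderType d) (a b : T) :
  (Some a <= Some b :> with_oo T)%O = (a <= b)%O.
Proof. by []. Qed.

Lemma oo_ltE d (T : orderType d) (a b : T) :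
  (Some a < Some b :> with_oo T)%O = (a < b)%O.
Proof. by rewrite !ltNge oo_leE. Qed.

Section OrderFiltration.
Variables (R : realType) (n : nat) (X : analytic_germ R n).
Local Notation C := R[i].
Local Notation O := (OX X).
Variables (r : nat) (d : Order.disp_t) (S : 'I_r -> oSemigroupType d).
Local Notation SS := (forall i, S i).

Section OneFiltration.
Variable nu : forall i, order_fun X (S i).

(** Only an inequality, since for [a = 0] the order jumps to infinity. *)
Lemma order_scale_le i a (g : O) : (nu i g <= nu i (a *: g))%O.
Proof.
have [->|a0] := eqVneq a 0; last by rewrite order_scale.
by rewrite scale0r order_0; case: (nu i g).
Qed.

Lemma subspace_ge i (x : with_oo (S i)) : subspace [set g : O | (x <= nu i g)%O].
Proof.
split=> [|a g1 g2] /=; first by rewrite order_0; case: x.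
move=> x1 x2; apply: le_trans (order_add _ _ _).
by rewrite le_min x2 (le_trans x1) ?order_scale_le.
Qed.

Lemma subspace_gt i (t : S i) :
  subspace [set g : O | (Some t < nu i g :> with_oo (S i))%O].
Proof.
split=> [|a g1 g2] /=; first by rewrite order_0 lt_neqAle.
move=> x1 x2; apply: lt_le_trans (order_add _ _ _).
by rewrite lt_min x2 (lt_le_trans x1) ?order_scale_le.
Qed.

(** Modulo [Jplus v], these are the intersections of the subspaces removed from J(v)/J^+(v) to
    obtain F_v. *)
Definition Jmixed (v : SS) (A : {set 'I_r}) : set O :=
  [set g | forall i, if i \in A then (Some (v i) < nu i g :> with_oo (S i))%O
                     else (Some (v i) <= nu i g :> with_oo (S i))%O].

Lemma Jmixed0 v : Jmixed v finset.set0 = J nu v.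
Proof.
by apply/seteqP; split=> g gP i; have := gP i; rewrite finset.in_set0.
Qed.

Lemma JmixedT v : Jmixed v [set: 'I_r]%SET = Jplus nu v.
Proof.
by apply/seteqP; split=> g gP i; have := gP i; rewrite finset.in_setT.
Qed.

Lemma JmixedU v i A g : Jmixed v (i |: A)%SET g <->
  Jmixed v A g /\ (Some (v i) < nu i g :> with_oo (S i))%O.
Proof.
split=> [gP|[gA gi] j].
  split=> [j|]; last by have := gP i; rewrite finset.in_setU1 eqxx.
  have := gP j; rewrite finset.in_setU1; case: (j \in A); rewrite (orbT, orbF) //.
  by case: eqP => // _ /ltW.
rewrite finset.in_setU1; case: eqP => [->|_] //=; exact: gA.
Qed.

Lemma subspace_Jmixed v A : subspace (Jmixed v A).
Proof.
split=> [i|a g1 g2 g1P g2P i].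
  by case: ifP => _; [case: (subspace_gt (v i)) | case: (subspace_ge (Some (v i)))].
have := g1P i; have := g2P i; case: ifP => _ x2 x1.
  by apply (subspace_gt (v i)).
by apply (subspace_ge (Some (v i))).
Qed.

Lemma subspace_J v : subspace (J nu v).
Proof. by rewrite -Jmixed0; exact: subspace_Jmixed. Qed.

Lemma subspace_Jplus v : subspace (Jplus nu v).
Proof. by rewrite -JmixedT; exact: subspace_Jmixed. Qed.

Lemma Jmixed_subset v (A B : {set 'I_r}) : A \subset B -> Jmixed v B `<=` Jmixed v A.
Proof.
move=> AB g gB i; have := gB i; case: (boolP (i \in A)) => [/(fintype.subsetP AB) ->|] //.
by case: ifP => // _ _ /ltW.
Qed.

Lemma Jplus_Jmixed v A : Jplus nu v `<=` Jmixed v A.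
Proof. by rewrite -JmixedT; apply: Jmixed_subset; exact: finset.subsetT. Qed.

Lemma Jmixed_J v A : Jmixed v A `<=` J nu v.
Proof. by rewrite -Jmixed0; apply: Jmixed_subset; exact: finset.sub0set. Qed.

Lemma Jplus_J v : Jplus nu v `<=` J nu v.
Proof. by rewrite -Jmixed0; exact: Jplus_Jmixed. Qed.

Lemma J_mono (v w : SS) : (forall i, (v i <= w i)%O) -> J nu w `<=` J nu v.
Proof.
by move=> vw g gw i; apply: le_trans (gw i); exact: vw.
Qed.

Lemma Y_J v g : Y nu v g -> J nu v g.
Proof. by move=> gv i; rewrite gv. Qed.

Lemma finite_YP g : (forall i, nu i g <> None) -> exists w, Y nu w g.
Proof.
move=> fin; have ex i : exists t, nu i g = Some t.
  by case: (nu i g) (fin i) => // t _; exists t.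
by exists (fun i => projT1 (cid (ex i))) => i; case: cid.
Qed.

Hypothesis S_nomax : forall i (s : S i), exists s' : S i, (s < s')%O.
Hypothesis finite_nu : forall v, finite_codim (J nu v).

Definition Jge i (t : S i) : set O := [set g | (Some t <= nu i g :> with_oo (S i))%O].

(** The other conditions are vacuous at the minimal element, so a condition on one index inherits
    finite codimension. *)
Lemma JgeE i (t : S i) :
  Jge t = J nu (eqtype.dfwith (fun j => \bot%O : S j) t).
Proof.
apply/seteqP; split=> [g gt j|g /(_ i)]; last by rewrite dfwith_in.
case: eqtype.dfwithP => [//|k _]; case: (nu k g) => [x|//]; exact: le0x.
Qed.

Lemma finite_Jge i (t : S i) : finite_codim (Jge t).
Proof. by rewrite JgeE. Qed.

(** Take [t] above [s] with [Jge t] of least codimension: a [u] strictly between them gives a space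
    that is larger but of no smaller codimension, hence the same. *)
Lemma Jge_gt i (s : S i) : exists2 t, (s < t)%O & forall g,
  (Some s < nu i g :> with_oo (S i))%O -> Jge t g.
Proof.
have ex_k : exists k, `[< exists2 t, (s < t)%O & codim (Jge t) = k >].
  by have [t st] := S_nomax s; exists (codim (Jge t)); apply/asboolP; exists t.
have [_ /asboolP[t st <-] mint] := ex_minnP ex_k.
exists t => // g sg; case E: (nu i g) => [u|]; last by rewrite /Jge /= E.
have su : (s < u)%O by move: sg; rewrite E oo_ltE.
have [tu|ut] := leP t u; first by rewrite /Jge /= E.
have -> : Jge t = Jge u; last by rewrite /Jge /= E lexx.
apply/esym/codim_eq; [exact: subspace_ge| exact: subspace_ge | exact: finite_Jge..|
  | ].
  by move=> h; apply: le_trans; rewrite oo_leE ltW.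
by apply: mint; apply/asboolP; exists u.
Qed.

(** The order functions do not enter, so a [w] found for one collection can be used with another. *)
Definition shifted (v : SS) (A : {set 'I_r}) (w : SS) :=
  forall i, if i \in A then (v i < w i)%O : Prop else w i = v i.

Lemma shifted_le v A w : shifted v A w -> forall i, (v i <= w i)%O.
Proof. by move=> vw i; have := vw i; case: ifP => [_ /ltW|_ ->]. Qed.

Lemma shifted_J v A w : shifted v A w -> J nu w `<=` Jmixed v A.
Proof.
move=> vw g gw i; have := vw i; case: ifP => _ vi; last by rewrite -vi; exact: gw.
by apply: lt_le_trans (gw i); rewrite oo_ltE.
Qed.

Lemma Jmixed_shifted v A : exists2 w, shifted v A w & Jmixed v A = J nu w.
Proof.
pose t i := s2val (cid2 (Jge_gt (v i))).
pose w i := if i \in A then t i else v i.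
have vw : shifted v A w.
  by move=> i; rewrite /w; case: (i \in A) => //; rewrite /t; case: cid2 => u /=.
exists w => //; apply/seteqP; split; last exact: shifted_J.
move=> g gA i; rewrite /w; have := gA i; case: (i \in A) => //.
by rewrite /t; case: cid2 => u /= _ /(_ g).
Qed.

Lemma finite_Jmixed v A : finite_codim (Jmixed v A).
Proof. by have [w _ ->] := Jmixed_shifted v A. Qed.

Lemma finite_Jplus v : finite_codim (Jplus nu v).
Proof. by rewrite -JmixedT; exact: finite_Jmixed. Qed.

Definition mixed_dim v A := (codim (Jplus nu v) - codim (Jmixed v A))%N.

Lemma rank_Jmixed v A m (e : 'I_m -> O) (W : 'M[C]_m) :
  basis_mod (J nu v) (Jplus nu v) e ->
  (forall c : 'rV_m, (c <= W)%MS <-> Jmixed v A (lincomb e c)) ->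
  \rank W = mixed_dim v A.
Proof.
move=> be WP; have [W' [W'P be']] := basis_mod_sub be (subspace_Jmixed v A)
  (subspace_Jplus v) (@Jplus_Jmixed v A) (@Jmixed_J v A).
rewrite /mixed_dim (codim_basis_mod (subspace_Jmixed v A) (subspace_Jplus v)
  (@Jplus_Jmixed v A) (finite_Jmixed v A) be') addKn.
apply/eqP; rewrite eqn_leq; apply/andP; split; apply: mxrankS;
  apply/row_subP => i; [apply/W'P/WP | apply/WP/W'P]; exact: row_sub.
Qed.

(** The two recursions run in parallel: intersecting with [V i] adds [i] to the strict conditions.
    Hence only codimensions matter. *)
Lemma arr_poly_Jmixed v m (e : 'I_m -> O) (V : 'I_r -> 'M[C]_m) s W A :
  basis_mod (J nu v) (Jplus nu v) e ->
  (forall i (c : 'rV_m), (c <= V i)%MS <->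
    (Some (v i) < nu i (lincomb e c) :> with_oo (S i))%O) ->
  (forall c : 'rV_m, (c <= W)%MS <-> Jmixed v A (lincomb e c)) ->
  arr_poly W [seq V i | i <- s] = incl_excl (mixed_dim v) s A.
Proof.
move=> be VP; elim: s W A => [|i s IH] W A WP /=.
  by rewrite (rank_Jmixed be WP).
rewrite (IH W A) // (IH (W :&: V i)%MS (i |: A)%SET) // => c.
rewrite sub_capmx; split=> [/andP[/WP cW /VP cV]|/JmixedU[/WP-> /VP->]] //.
by apply/JmixedU.
Qed.

Definition fiber_poly v := incl_excl (mixed_dim v) (enum 'I_r) finset.set0.

Lemma PF_coordsP v m (e : 'I_m -> O) c : basis_mod (J nu v) (Jplus nu v) e ->
  PF_coords nu v e c <-> c != 0 /\
    forall i, ~ (Some (v i) < nu i (lincomb e c) :> with_oo (S i))%O.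
Proof.
(* In [PF_coords] the coordinate vector is compared to 0 as a function. *)
move=> [Je _ _]; split=> [[c0 [g gY cg]]|[c0 cY]]; split.
- by apply: contraNneq c0 => ->; apply/eqP; do 2!apply/funext => ?; rewrite mxE.
- move=> i ci; have [/(_ ci) /=] := subspace_congr (subspace_gt (v i)) (cg i).
  by rewrite gY ltxx.
- apply: contraNneq c0 => cE; apply/eqP/rowP => j.
  by rewrite mxE; exact: (congr1 (fun f => f 0 j) cE).
exists (lincomb e c); last by rewrite subrr; case: (subspace_Jplus v).
have cJ : J nu v (lincomb e c) by apply: lincomb_sub => //; exact: subspace_J.
move=> i; have := cJ i; have := cY i.
by rewrite le_eqVlt => nlt /orP[/eqP <-|].
Qed.

Lemma PF_coords_arr v m (e : 'I_m -> O) : basis_mod (J nu v) (Jplus nu v) e ->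
  exists2 V : 'I_r -> 'M[C]_m,
    (forall i (c : 'rV_m), (c <= V i)%MS <->
      (Some (v i) < nu i (lincomb e c) :> with_oo (S i))%O) &
    PF_coords nu v e = arr_set 1%:M [seq V i | i <- enum 'I_r].
Proof.
move=> be.
have ex i : exists V : 'M[C]_m, forall c : 'rV_m, (c <= V)%MS <->
    (Some (v i) < nu i (lincomb e c) :> with_oo (S i))%O.
  apply: (@subspace_mx _ _
    [set c | (Some (v i) < nu i (lincomb e c) :> with_oo (S i))%O]).
  have [s0 sD] := subspace_gt (v i).
  split=> [|a x y] /=; first by rewrite lincomb0; exact: s0.
  by rewrite lincomb_is_linear; exact: sD.
have [V VP] := choice ex; exists V => //.
apply/seteqP; split=> c /=.
  move=> /(PF_coordsP _ be)[c0 cV]; split=> //; first exact: submx1.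
  by rewrite all_map; apply/allP => i _ /=; apply/negP => /VP/cV.
move=> [c0 _ cV]; apply/(PF_coordsP _ be); split=> // i /VP ci.
by move: cV; rewrite all_map => /allP/(_ i); rewrite mem_enum /= ci => /(_ isT).
Qed.

Lemma K0_class_fiber v m (e : 'I_m -> O) (Z : qpvar C m) :
  basis_mod (J nu v) (Jplus nu v) e -> pts Z = PF_coords nu v e ->
  K0_class Z = K0_poly C (fiber_poly v).
Proof.
move=> be ZE; have [V VP arrE] := PF_coords_arr be.
rewrite /fiber_poly -(arr_poly_Jmixed (W := 1%:M) _ be VP).
  by rewrite -K0_class_arrangement; apply: K0_class_pts; rewrite ZE.
move=> c; rewrite submx1 Jmixed0; split=> // _.
by apply: lincomb_sub; [exact: subspace_J | case: be].
Qed.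

(** A basis exists because [Jplus v] has finite codimension, so the default value in [PF_class] is
    not reached. *)
Lemma PF_classP v : exists m (e : 'I_m -> O) (Z : qpvar C m),
  [/\ basis_mod (J nu v) (Jplus nu v) e, pts Z = PF_coords nu v e &
      PF_class nu v = K0_class Z].
Proof.
apply: (@xgetPex _ 0 [set a | exists m (e : 'I_m -> O) (Z : qpvar C m),
  [/\ basis_mod (J nu v) (Jplus nu v) e, pts Z = PF_coords nu v e &
      a = K0_class Z]]).
have [m [e be]] := finite_basis_mod (subspace_J v) (subspace_Jplus v)
  (@Jplus_J v) (finite_Jplus v).
have [V _ arrE] := PF_coords_arr be.
exists (K0_class (arrangement 1%:M [seq V i | i <- enum 'I_r])), m, e.
by exists (arrangement 1%:M [seq V i | i <- enum 'I_r]); split.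
Qed.

(** * Coefficients of the Poincare series *)

Hypothesis Z_L_injective : injective (@K0_poly R[i]).

Lemma PF_polyE v : PF_poly nu v = fiber_poly v.
Proof.
apply: Z_L_injective; have [m [e [Z [be ZE PE]]]] := PF_classP v.
rewrite -(K0_class_fiber be ZE) -PE.
apply: (@xgetPex _ 0 [set p | K0_poly C p = PF_class nu v]).
by exists (fiber_poly v) => /=; rewrite PE (K0_class_fiber be ZE).
Qed.

Lemma fiber_poly_eq0 v : (forall g, ~ Y nu v g) -> fiber_poly v = 0.
Proof.
move=> Y0; apply: Z_L_injective; have [m [e [Z [be ZE _]]]] := PF_classP v.
rewrite -(K0_class_fiber be ZE) K0_poly0; apply: K0_class_empty.
by rewrite ZE; apply/seteqP; split=> c //= [_ [g /Y0]].
Qed.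

Lemma size_fiber_poly v : (size (fiber_poly v) <= codim (Jplus nu v) - codim (J nu v))%N.
Proof.
apply: size_incl_excl => B _; rewrite /mixed_dim leq_sub2l //.
apply: codimS (@Jmixed_J v B); [exact: subspace_J|exact: subspace_Jmixed|
 exact: finite_nu|exact: finite_Jmixed].
Qed.

Lemma coef_poincare v j : (poincare_series nu v)`_j =
  if (j < codim (Jplus nu v))%N then (fiber_poly v)`_((codim (Jplus nu v)).-1 - j) else 0.
Proof.
rewrite /poincare_series PF_polyE; apply: coef_reversed.
exact: leq_trans (size_fiber_poly v) (leq_subr _ _).
Qed.

Lemma poincare_eq0 v : (forall g, ~ Y nu v g) -> poincare_series nu v = 0.
Proof.
move=> Y0; apply/polyP => j.
by rewrite coef_poincare fiber_poly_eq0 // !coef0 if_same.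
Qed.

Lemma codim_Jmixed_gt v g A : Y nu v g -> A != finset.set0 ->
  (codim (J nu v) < codim (Jmixed v A))%N.
Proof.
move=> gY /finset.set0Pn[i iA]; rewrite ltnNge; apply/negP => le.
have JE : J nu v = Jmixed v A.
  apply: codim_eq le; [exact: subspace_J|exact: subspace_Jmixed|exact: finite_nu|
    exact: finite_Jmixed|exact: Jmixed_J].
have : Jmixed v A g by rewrite -JE; exact: Y_J.
by move=> /(_ i); rewrite iA gY ltxx.
Qed.

Lemma codim_lt_Jplus v g : (0 < r)%N -> Y nu v g ->
  (codim (J nu v) < codim (Jplus nu v))%N.
Proof.
move=> r0 gY; rewrite -JmixedT; apply: codim_Jmixed_gt gY _.
by apply/finset.set0Pn; exists (Ordinal r0); rewrite finset.in_setT.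
Qed.

(** The degree of p_v is less than h^+ - h, so reversal at h^+ - 1 puts no term below h. *)
Lemma poincare_coef_low v j : (j < hilbert_fun nu v)%N -> (poincare_series nu v)`_j = 0.
Proof.
move=> jh; rewrite coef_poincare; case: ifP => // jp.
rewrite nth_default //; apply: leq_trans (size_fiber_poly v) _.
by rewrite -subn1 -subnDA leq_sub2l // add1n.
Qed.

(** This coefficient comes from degree h^+ - h - 1 of p_v. The whole projective space contributes 1;
    the removed subspaces do not contain the class of [g], so they have smaller dimension. *)
Lemma poincare_coef_hilbert v g : (0 < r)%N -> Y nu v g ->
  (poincare_series nu v)`_(hilbert_fun nu v) = 1.
Proof.
move=> r0 gY; have lt := codim_lt_Jplus r0 gY.
rewrite coef_poincare lt; apply: coef_incl_excl.
- by move=> i _; rewrite finset.in_set0.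
- rewrite /mixed_dim Jmixed0 -subn1 -subnDA add1n ltn_sub2lE //.
- move=> B; rewrite finset.proper0 => /(codim_Jmixed_gt gY) hB.
  by rewrite /mixed_dim -subn1 -subnDA add1n leq_sub2l.
Qed.

Lemma size_poincare v : (size (poincare_series nu v) <= codim (Jplus nu v))%N.
Proof.
by apply/leq_sizeP => j; rewrite coef_poincare leqNgt => /negbTE ->.
Qed.

(** Each [nu i] has a least value [w i] on [J v], and an element avoiding all the subspaces of
    larger order attains every minimum at once. *)
Lemma generic_value v : (forall i, exists2 g, J nu v g & nu i g <> None) ->
  exists w, [/\ forall i, (v i <= w i)%O, exists g, Y nu w g & J nu v = J nu w].
Proof.
move=> fin.
have ex i : exists t : S i, (exists2 g, J nu v g & nu i g = Some t) /\
    forall g, J nu v g -> Jge t g.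
  (* [S i] need not be well ordered, so the least value is found by minimizing a codimension. *)
  have ex_k : exists k, `[< exists2 t : S i, (exists2 g, J nu v g & nu i g = Some t) &
      codim (Jge t) = k >].
    have [g gJ] := fin i; case E: (nu i g) => [t|//] _.
    by exists (codim (Jge t)); apply/asboolP; exists t => //; exists g.
  have [_ /asboolP[t tJ <-] mint] := ex_minnP ex_k.
  exists t; split=> // g gJ; case E: (nu i g) => [u|]; last by rewrite /Jge /= E.
  have [tu|ut] := leP t u; first by rewrite /Jge /= E.
  have -> : Jge t = Jge u; last by rewrite /Jge /= E lexx.
  apply/esym/codim_eq; [exact: subspace_ge|exact: subspace_ge|exact: finite_Jge..| | ].
    by move=> h; apply: le_trans; rewrite oo_leE ltW.
  by apply: mint; apply/asboolP; exists u => //; exists g.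
pose w i := projT1 (cid (ex i)).
have wJ i : exists2 g, J nu v g & nu i g = Some (w i).
  by rewrite /w; case: cid => t [].
have w_min i g : J nu v g -> Jge (w i) g.
  by rewrite /w; case: cid => t /= [_ tmin]; exact: tmin.
have vw i : (v i <= w i)%O.
  by have [g gJ gE] := wJ i; have := gJ i; rewrite gE.
exists w; split=> //.
  have [|g gJ gP] := subspace_avoid (fun i => subspace_gt (w i)) (s := enum 'I_r)
    (subspace_J v).
    by move=> i _; have [g gJ gE] := wJ i; exists g => //=; rewrite gE ltxx.
  exists g => i; have := gP i (mem_enum _ _); have := w_min i g gJ.
  by rewrite /Jge /= le_eqVlt => /orP[/eqP -> //|].
apply/seteqP; split; last exact: J_mono.
by move=> g gJ i; exact: w_min.
Qed.

(* When no element of [J v] has finite orders, [J v] is the set of all elements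
   of infinite orders and its codimension is the largest size of a coefficient
   of the Poincare series, reached at the maximal elements of the value set. *)
Lemma hilbert_fun_cases v : proper_at_infinity nu ->
  (exists w, [/\ forall i, (v i <= w i)%O, exists g, Y nu w g &
     hilbert_fun nu v = hilbert_fun nu w]) \/
  [/\ (0 < r)%N, forall w g, (forall i, (v i <= w i)%O) -> ~ Y nu w g,
      forall w, (size (poincare_series nu w) <= hilbert_fun nu v)%N &
      hilbert_fun nu v = 0%N \/
      exists w, size (poincare_series nu w) = hilbert_fun nu v].
Proof.
move=> proper_nu.
have [fin|] := pselect (forall i, exists2 g, J nu v g & nu i g <> None).
  left; have [w [vw gw JE]] := generic_value fin.
  by exists w; split=> //; rewrite /hilbert_fun JE.
move=> /existsNP[i /forall2NP vi]; right.
have JN g : J nu v g -> nu i g = None.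
  by move=> gJ; have [|/contrapT] := vi g.
have sN j : subspace [set g : O | nu j g = None].
  have -> : [set g : O | nu j g = None] =
      [set g : O | ((None : with_oo (S j)) <= nu j g)%O].
    by apply/seteqP; split=> g /=; [move=> -> | case: (nu j g)].
  exact: subspace_ge.
(* This set contains [J v], so properness at infinity applies to it. *)
have fN : finite_codim [set g : O | nu i g = None].
  exact: finite_codimS (sN i) JN (finite_nu v).
have N_all j g : nu i g = None -> nu j g = None by exact: proper_nu.
have NJ w g : nu i g = None -> J nu w g by move=> gN j; rewrite N_all.
(* Properness also applies to every [j], since the infinite elements of [nu j] contain those of
   [nu i]: orders are all finite or all infinite. *)
have NY g : nu i g <> None -> exists w, Y nu w g.
  move=> gN; apply: finite_YP => j gj; apply: gN.
  apply: (proper_nu j _ i g gj); apply: finite_codimS (sN j) _ fN.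
  by move=> h; exact: N_all.
have r0 : (0 < r)%N by exact: leq_ltn_trans (ltn_ord i).
have JE w : (forall g, J nu w g -> nu i g = None) -> J nu w = J nu v.
  by move=> wN; apply/seteqP; split=> g => [/wN|/JN]; exact: NJ.
have h_le w : (hilbert_fun nu w <= hilbert_fun nu v)%N.
  apply: codimS; [exact: subspace_J|exact: subspace_J|exact: finite_nu..|].
  by move=> g /JN; exact: NJ.
have hp_le w : (codim (Jplus nu w) <= hilbert_fun nu v)%N.
  apply: codimS; [exact: subspace_Jplus|exact: subspace_J|exact: finite_Jplus|
    exact: finite_nu|].
  by move=> g /JN gN j; rewrite N_all.
split=> //.
- move=> w g vw gY; suff : nu i g = None by rewrite gY.
  by apply: JN; apply: J_mono (Y_J gY).
- by move=> w; apply: leq_trans (size_poincare w) _.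
(* If the codimension is zero, every order is infinite and there is no maximal value to choose
   below. *)
have [h0|h0] := eqVneq (hilbert_fun nu v) 0%N; [by left|right].
have ex_g : exists g, nu i g <> None.
  apply/existsNP => allN; move/eqP: h0; apply.
  apply: (@codimE _ _ _ 0 (fun=> 0)); first exact: subspace_J.
  split=> // [g _|c _]; last by rewrite thinmx0.
  by exists 0; exact: NJ.
have ex_k : exists k, `[< exists2 w, (exists g, Y nu w g) & hilbert_fun nu w = k >].
  have [g /NY[w gY]] := ex_g.
  by exists (hilbert_fun nu w); apply/asboolP; exists w => //; exists g.
have le_k k : `[< exists2 w, (exists g, Y nu w g) & hilbert_fun nu w = k >] ->
    (k <= hilbert_fun nu v)%N.
  by move=> /asboolP[w _ <-].
have [_ /asboolP[w [g0 g0Y] <-] maxw] := ex_maxnP ex_k le_k.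
exists w.
(* A finite element satisfying a strict condition at [w] would have a value [u] above [w].
   Maximality gives [J w = J u], which excludes [g0], whose order at [j] is too small. *)
have mixedE A : A != finset.set0 -> Jmixed w A = J nu v.
  move=> /finset.set0Pn[j jA]; have [w' ww' ->] := Jmixed_shifted w A.
  apply: JE => g gJ; apply: contrapT => /NY[u gY].
  have w'u k : (w' k <= u k)%O by have := gJ k; rewrite gY.
  have wu k : (w k <= u k)%O by apply: le_trans (w'u k); exact: shifted_le ww' k.
  have Ju : J nu w = J nu u.
    apply: codim_eq; [exact: subspace_J|exact: subspace_J|exact: finite_nu..|
      exact: J_mono|].
    by apply: maxw; apply/asboolP; exists u => //; exists g.
  have : J nu w' g0 by apply: J_mono w'u _ _; rewrite -Ju; exact: Y_J.
  move=> /(_ j); rewrite g0Y; have := ww' j; rewrite jA => lt.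
  by rewrite oo_leE leNgt lt.
have hpE : codim (Jplus nu w) = hilbert_fun nu v.
  rewrite -JmixedT mixedE //; apply/finset.set0Pn.
  by exists i; rewrite finset.in_setT.
apply/eqP; rewrite eqn_leq; apply/andP; split.
  by apply: leq_trans (size_poincare w) _; rewrite hpE.
rewrite -[leqLHS]prednK ?lt0n //; apply: contraTT isT; rewrite -leqNgt => le.
have := coef_poincare w (hilbert_fun nu v).-1.
rewrite hpE subnn nth_default // ltn_predL lt0n h0 => /esym/eqP.
(* All removed subspaces are zero, so the constant term of p_w is that of the whole projective
   space; reversal moves it to the index h(v) - 1. *)
rewrite (_ : (fiber_poly w)`_0 = 1) ?oner_eq0 //.
apply: coef_incl_excl => [j _||B]; first by rewrite finset.in_set0.
  by rewrite /mixed_dim Jmixed0 subn_gt0; exact: codim_lt_Jplus r0 g0Y.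
by rewrite finset.proper0 /mixed_dim hpE => /mixedE ->; rewrite subnn.
Qed.

End OneFiltration.

(** * Comparison of two collections of order functions *)

Section TwoFiltrations.
Hypothesis S_nomax : forall i (s : S i), exists s' : S i, (s < s')%O.
Hypothesis Z_L_injective : injective (@K0_poly R[i]).
Variables nu nu' : forall i, order_fun X (S i).
Hypothesis finite_nu : forall v, finite_codim (J nu v).
Hypothesis finite_nu' : forall v, finite_codim (J nu' v).

(** A [w] that is exact for [nu'] still gives an inclusion for [nu]; exchanging the two collections
    yields equality. *)
Lemma codim_Jmixed_le v A : hilbert_fun nu = hilbert_fun nu' ->
  (codim (Jmixed nu v A) <= codim (Jmixed nu' v A))%N.
Proof.
move=> hE; have [w vw ->] := Jmixed_shifted S_nomax finite_nu' v A.
rewrite -[leqRHS]/(hilbert_fun nu' w) -hE; apply: codimS (shifted_J vw);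
  [exact: subspace_Jmixed|exact: subspace_J|exact: finite_Jmixed|exact: finite_nu].
Qed.

(** The coefficient 1 at the index h(v) is shared by the other series, which is zero if [Y nu' v] is
    empty and otherwise has no term below its own h. *)
Lemma poincare_value v g : (0 < r)%N ->
  poincare_series nu v = poincare_series nu' v -> Y nu v g ->
  (exists g', Y nu' v g') /\ (hilbert_fun nu' v <= hilbert_fun nu v)%N.
Proof.
move=> r0 PE gY; have := poincare_coef_hilbert S_nomax finite_nu Z_L_injective r0 gY.
rewrite PE => P1; split; last first.
  rewrite leqNgt; apply/negP => lt; move/eqP: P1.
  by rewrite (poincare_coef_low S_nomax finite_nu' Z_L_injective lt) eq_sym oner_eq0.
apply: contrapT => /forallNP Y0; move/eqP: P1.
by rewrite (poincare_eq0 S_nomax finite_nu' Z_L_injective Y0) coef0 eq_sym oner_eq0.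
Qed.

End TwoFiltrations.

(** One inequality suffices by symmetry. Either h(v) is attained at a value above [v], to which
    [poincare_value] applies, or it bounds the sizes of all coefficients. *)
Lemma hilbert_fun_poincare_le
    (S_nomax : forall i (s : S i), exists s' : S i, (s < s')%O)
    (Z_L_injective : injective (@K0_poly R[i]))
    (nu nu' : forall i, order_fun X (S i))
    (finite_nu : forall v, finite_codim (J nu v))
    (finite_nu' : forall v, finite_codim (J nu' v)) v :
  proper_at_infinity nu -> proper_at_infinity nu' ->
  poincare_series nu = poincare_series nu' ->
  (hilbert_fun nu' v <= hilbert_fun nu v)%N.
Proof.
move=> proper_nu proper_nu' PE.
have [r0|r_le0] := ltnP 0 r; last first.
  (* Without indices all conditions are vacuous. *)
  rewrite /hilbert_fun (_ : J nu v = J nu' v) //.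
  by apply/seteqP; split=> g _ i; have := leq_trans (ltn_ord i) r_le0.
have := hilbert_fun_cases S_nomax finite_nu Z_L_injective v proper_nu.
move=> [[w [vw [g gY] ->]]|[_ noY size_le _]].
  have [_ hw] := poincare_value S_nomax Z_L_injective finite_nu finite_nu' r0
    (congr1 (fun P => P w) PE) gY.
  apply: leq_trans hw; apply: codimS (J_mono vw); [exact: subspace_J|
    exact: subspace_J|exact: finite_nu'..].
(* The collections share their values, so [nu'] has none above [v] either, and its h(v) is zero or
   the size of a common coefficient. *)
have := hilbert_fun_cases S_nomax finite_nu' Z_L_injective v proper_nu'.
move=> [[w [vw [g gY] _]]|[_ _ _ [->//|[w <-]]]]; last by rewrite -PE.
have [[g' gY'] _] := poincare_value S_nomax Z_L_injective finite_nu' finite_nu r0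
  (congr1 (fun P => P w) (esym PE)) gY.
by case: (noY w g' vw).
Qed.

End OrderFiltration.

Theorem proposition1 (R : realType) (n : nat) (X : analytic_germ R n)
    (r : nat) (d : Order.disp_t) (S : 'I_r -> oSemigroupType d)
    (S_nomax : forall i (s : S i), exists s' : S i, (s < s')%O)
    (Z_L_injective : injective (@K0_poly R[i]))
    (nu nu' : forall i, order_fun X (S i))
    (finite_nu : forall v, finite_codim (J nu v))
    (finite_nu' : forall v, finite_codim (J nu' v)) :
  [/\ hilbert_fun nu = hilbert_fun nu' ->
        hilbert_series nu = hilbert_series nu' /\
        poincare_series nu = poincare_series nu',
      hilbert_series nu = hilbert_series nu' ->
        hilbert_fun nu = hilbert_fun nu' /\
        poincare_series nu = poincare_series nu' &
      proper_at_infinity nu -> proper_at_infinity nu' ->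
      poincare_series nu = poincare_series nu' ->
        hilbert_fun nu = hilbert_fun nu' /\
        hilbert_series nu = hilbert_series nu'].
Proof.
have fun_to_series : hilbert_fun nu = hilbert_fun nu' ->
    hilbert_series nu = hilbert_series nu'.
  by move=> hE; apply/funext => v; rewrite /hilbert_series hE.
have series_to_fun : hilbert_series nu = hilbert_series nu' ->
    hilbert_fun nu = hilbert_fun nu'.
  (* Coefficients are naturals embedded in [int] by a constructor, which [case] inverts. *)
  by move=> HE; apply/funext => v; case: (congr1 (fun H => H v) HE).
have fun_to_poincare : hilbert_fun nu = hilbert_fun nu' ->
    poincare_series nu = poincare_series nu'.
  move=> hE; have mixedE v A : codim (Jmixed nu v A) = codim (Jmixed nu' v A).
    by apply/eqP; rewrite eqn_leq !codim_Jmixed_le.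
  apply/funext => v; rewrite /poincare_series /hilbert_fun_plus !PF_polyE //.
  have -> : fiber_poly nu v = fiber_poly nu' v.
    by congr incl_excl; apply/funext => A; rewrite /mixed_dim -!JmixedT !mixedE.
  by rewrite -!JmixedT mixedE.
split=> [hE|HE|proper_nu proper_nu' PE].
- by split; [exact: fun_to_series | exact: fun_to_poincare].
- by have hE := series_to_fun HE; split=> //; exact: fun_to_poincare.
suff hE : hilbert_fun nu = hilbert_fun nu' by split=> //; exact: fun_to_series.
by apply/funext => v; apply/eqP; rewrite eqn_leq !hilbert_fun_poincare_le.
Qed.
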